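(* Let $\mathcal L$ be a factorial and almost prolongable language over a finite alphabet $\mathcal A$ whose complexity function $p(n)$ is unbounded. The following are equivalent: (1) $p$ grows subexponentially and the Benjamini–Schramm limit of the Rauzy graphs $R(n)$ exists; (2) the Rauzy graphs $R(n)$ converge to the line $\mathbf Z$; (3) $p$ grows subexponentially and the empirical spectral measures $\mu_{R(n)}$ converge weakly; (4) the empirical spectral measures $\mu_{R(n)}$ converge weakly to the probability measure with density $\frac{1}{\pi\sqrt{4-x^2}}$ with respect to Lebesgue measure on $[-2,2]$; (5) $\lim_{n\to\infty}\frac{p(n+1)}{p(n)}=1$; (6) $p$ grows subexponentially and the Benjamini–Schramm limit of the Rauzy digraphs $\vec R(n)$ exists; (7) the Rauzy digraphs $\vec R(n)$ converge to the directed line $\vec{\mathbf Z}$.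
   Context: Let $\mathcal A$ be a finite alphabet with $k=|\mathcal A|\ge 2$ letters and $\mathcal A^*$ the set of finite words over $\mathcal A$. A language is a subset $\mathcal L\subseteq\mathcal A^*$; write $\mathcal L_n=\mathcal L\cap\mathcal A^n$ and $p(n)=|\mathcal L_n|$ (the complexity function). $\mathcal L$ is factorial if every subword (contiguous block) of a word of $\mathcal L$ lies in $\mathcal L$. A word $v\in\mathcal L$ is left-prolongable (resp. right-prolongable) if $av\in\mathcal L$ (resp. $va\in\mathcal L$) for some $a\in\mathcal A$; $\mathcal L$ is prolongable if every word is both left- and right-prolongable, and almost prolongable if the proportion of left-prolongable words in $\mathcal L_n$ and the proportion of right-prolongable words in $\mathcal L_n$ both tend to $1$ as $n\to\infty$. $p$ grows subexponentially if $\lim_n \frac1n\log p(n)=0$. For $n\ge1$, the Rauzy digraph $\vec R(n)$ has vertex set $\mathcal L_n$ and, for each word $aub\in\mathcal L_{n+1}$ ($a,b\in\mathcal A$, $u\in\mathcal A^{n-1}$) with $au,ub\in\mathcal L_n$, one arc from $au$ to $ub$ (loops and multiple arcs allowed). The Rauzy graph $R(n)$ is obtained by forgetting orientations. Benjamini–Schramm convergence: for a finite (di)graph $G$, let $\nu_G$ be the law of the isomorphism class of the rooted connected component $(G_v,v)$ of a uniformly random vertex $v$, in the compact space of (isomorphism classes of) rooted connected (di)graphs of bounded degree with the local topology; $(G_n)$ has Benjamini–Schramm limit $\nu$ if $\nu_{G_n}\to\nu$ weakly. Convergence to $\mathbf Z$ (resp. $\vec{\mathbf Z}$) means the limit is the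 Dirac mass at the bi-infinite path (resp. bi-infinite directed path with arcs $i\to i+1$); equivalently, for each $r$ the proportion of vertices whose ball of radius $r$ is isomorphic to the ball of radius $r$ in $\mathbf Z$ (resp. $\vec{\mathbf Z}$) tends to $1$. The empirical spectral measure of a finite graph $G$ with adjacency matrix $A_G$ (entry $(u,v)$ = number of edges between $u$ and $v$, diagonal entries counting loops) is $\mu_G=\frac{1}{|V(G)|}\sum_{\lambda}m_\lambda\delta_\lambda$, the sum over eigenvalues $\lambda$ of $A_G$ with multiplicities $m_\lambda$. *)

(* Defs.v *)
From HB Require Import structures.
From mathcomp Require Import all_boot all_order all_algebra.
From mathcomp Require Import all_classical all_reals all_analysis.
Set Implicit Arguments. Unset Strict Implicit. Unset Printing Implicit Defensive.
Import Order.TTheory GRing.Theory Num.Theory.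
Import numFieldNormedType.Exports.
Local Open Scope classical_set_scope.
Local Open Scope ring_scope.

(* Finite (di)multigraphs: a vertex finType V and arc-multiplicities   *)
(* m x y (number of arcs x -> y; for an undirected multigraph m is     *)
(* symmetric and m x y is the number of edges between x and y, m x x   *)
(* the number of loops at x).                                           *)

Definition gadj (V : finType) (m : V -> V -> nat) (x y : V) : bool :=
  (0 < m x y + m y x)%N.

Fixpoint gball (V : finType) (m : V -> V -> nat) (r : nat) (v : V) : {set V} :=
  match r with
  | 0 => [set v]
  | r'.+1 => gball m r' v :|: [set y | [exists x in gball m r' v, gadj m x y]]
  end.

Definition ball_iso (V W : finType) (m : V -> V -> nat) (mW : W -> W -> nat)
    (r : nat) (v : V) (w : W) : Prop :=
  exists f : V -> W,
    [/\ f v = w,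
        {in gball m r v &, injective f},
        f @: gball m r v = gball mW r w &
        {in gball m r v &, forall x y, m x y = mW (f x) (f y)}].

Definition ball_freq (R : realType) (V W : finType) (m : V -> V -> nat)
    (mW : W -> W -> nat) (r : nat) (w : W) : R :=
  (#|[set v : V | `[< ball_iso m mW r v w >] ]|%:R / #|V|%:R).

(* Benjamini--Schramm convergence of a sequence of finite (di)graphs
   (of uniformly bounded degree): for every radius r and every finite
   rooted (di)graph (H, o), the proportion of vertices whose r-ball is
   isomorphic to the r-ball of (H, o) converges. *)
Definition BS_limit_exists (R : realType) (V : nat -> finType)
    (m : forall n, V n -> V n -> nat) : Prop :=
  forall (r k : nat) (mH : 'I_k -> 'I_k -> nat) (o : 'I_k),
    exists l : R, (fun n => ball_freq R (m n) mH r o) @ \oo --> l.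

(* The ball of radius r in Z: the path 0 - 1 - ... - 2r rooted at r. *)
Definition Zline (r : nat) (i j : 'I_(r.*2.+1)) : nat :=
  ((i.+1 == j :> nat) || (j.+1 == i :> nat))%N.
Definition dZline (r : nat) (i j : 'I_(r.*2.+1)) : nat :=
  (i.+1 == j :> nat)%N.
Definition Zroot (r : nat) : 'I_(r.*2.+1) := inord r.

Definition BS_conv_to_Z (R : realType) (V : nat -> finType)
    (m : forall n, V n -> V n -> nat) : Prop :=
  forall r : nat, (fun n => ball_freq R (m n) (@Zline r) r (Zroot r)) @ \oo --> (1 : R).
Definition BS_conv_to_dZ (R : realType) (V : nat -> finType)
    (m : forall n, V n -> V n -> nat) : Prop :=
  forall r : nat, (fun n => ball_freq R (m n) (@dZline r) r (Zroot r)) @ \oo --> (1 : R).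

Section Language.
Variables (A : finType) (L : pred (seq A)).

Definition Lw (n : nat) : finType := {t : n.-tuple A | L t}.

Definition complexity (n : nat) : nat := #|{: Lw n}|.

Definition factorial_lang : Prop :=
  forall u x v : seq A, L (u ++ x ++ v) -> L x.

Definition left_prolongable (w : seq A) : bool := [exists a : A, L (a :: w)].
Definition right_prolongable (w : seq A) : bool := [exists a : A, L (rcons w a)].

Definition almost_prolongable (R : realType) : Prop :=
  (fun n => #|[set w : Lw n | left_prolongable (val w)]|%:R / (complexity n)%:R : R)
     @ \oo --> (1 : R) /\
  (fun n => #|[set w : Lw n | right_prolongable (val w)]|%:R / (complexity n)%:R : R)
     @ \oo --> (1 : R).

Definition unbounded_complexity : Prop := forall M : nat, exists n, (M < complexity n)%N.

Definition subexponential (R : realType) : Prop :=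
  (fun n => ln ((complexity n)%:R : R) / n%:R) @ \oo --> (0 : R).

Definition rauzy_arcs (n : nat) (x y : Lw n) : nat :=
  #|[set w : Lw n.+1 | (take n (val w) == val x :> seq A)
                        && (drop 1 (val w) == val y :> seq A)]|.

Definition rauzy_edges (n : nat) (x y : Lw n) : nat :=
  if x == y then rauzy_arcs x x else (rauzy_arcs x y + rauzy_arcs y x)%N.

Definition rauzy_adj (R : realType) (n : nat) : 'M[R]_(#|{: Lw n}|) :=
  \matrix_(i, j) (rauzy_edges (enum_val i) (enum_val j))%:R.

End Language.

(* integral of f against the empirical spectral measure of a symmetric real
   matrix M: (1/N) sum over the eigenvalues lambda (roots of the
   characteristic polynomial, all real) of m_lambda f(lambda) *)
Definition spectral_integral (R : realType) (N : nat) (M : 'M[R]_N) (f : R -> R) : R :=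
  N%:R^-1 * (\sum_(x \in [set x : R | root (char_poly M) x]) (mup x (char_poly M))%:R * f x).

Definition bounded_continuous (R : realType) (f : R -> R) : Prop :=
  continuous f /\ exists M : R, forall x, `|f x| <= M.

Definition spectral_weak_cvg (R : realType) (N : nat -> nat)
    (M : forall n, 'M[R]_(N n)) (nu : probability R R) : Prop :=
  forall f : R -> R, bounded_continuous f ->
    (fun n => (spectral_integral (M n) f)%:E) @ \oo --> (\int[nu]_x (f x)%:E)%E.

Definition spectral_cvg_arcsine (R : realType) (N : nat -> nat)
    (M : forall n, 'M[R]_(N n)) : Prop :=
  forall f : R -> R, bounded_continuous f ->
    (fun n => (spectral_integral (M n) f)%:E) @ \oo -->
      (\int[lebesgue_measure]_(x in `[(-2)%R, 2%R]%classic) ((f x / (pi * Num.sqrt (4 - x ^+ 2)))%R)%:E)%E.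

(* Main.v *)
(* Since p(n+1) is the number of arcs of the Rauzy digraph and almost all words are
   prolongable, p(n+1)/p(n) is close to 1 exactly when almost all vertices have in- and
   out-degree 1.  Discarding the boundedly many vertices lying on short cycles (these are
   periodic words), almost every vertex then has a directed line of radius r around it.
   Subexponential growth makes p(n+1)/p(n) come close to 1 for infinitely many n, so the
   only possible limits are those of the line.  Conversely, the degree of a vertex whose
   1-ball is that of Z, or the second moment of the spectral measure, bounds
   2 p(n+1)/p(n) by 2 + o(1).

   On a line the adjacency operator is S + S^-1, and the Chebyshev polynomial C_j with
   C_j(2 cos t) = 2 cos (j t) maps it to S^j + S^-j, which has zero diagonal for j > 0,
   just as C_j has zero mean for the image of the uniform law on [0, pi] under 2 cos.  So all
   moments of the spectral measures converge, and Weierstrass approximation applies. *)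
Require Import Defs.
From HB Require Import structures.
From mathcomp Require Import all_boot all_order all_algebra.
From mathcomp Require Import all_classical all_reals all_analysis.
From mathcomp Require Import measurable_realfun complex spectral ring lra zify.
Set Implicit Arguments. Unset Strict Implicit. Unset Printing Implicit Defensive.
Import Order.TTheory GRing.Theory Num.Theory.
Import numFieldNormedType.Exports.
Local Open Scope ring_scope.

(** * Balls, ball isomorphisms and line neighbourhoods *)

(** Everything rests on one estimate valid at each single large [n]: if p(n+1) is at most (1+d)
    p(n), then all but e p(n) words of length [n] have a line neighbourhood. In this form it applies
    both for all large [n], when the ratios converge, and along the sparse indices supplied by
    subexponential growth, where an assumed limit is identified.

    The discarded periodic words and the loops are bounded in number, hence negligible only if p(n)
    tends to infinity. Unboundedness does not give this at once, since words may fail to be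
    prolongable and [p] may decrease; a Morse-Hedlund argument at lengths where every word is
    right-prolongable fills the gap.

    Line neighbourhoods are defined in the digraph only. Symmetrizing arcs carries them to
    undirected balls, and the same path computes diagonal entries of polynomials in the adjacency
    matrix. Such an entry at a line vertex is exactly the arcsine mean of the polynomial, so
    spectral errors come only from exceptional vertices and from polynomial approximation. *)

Section Balls.
Variables (V : finType) (m : V -> V -> nat).

Lemma gadj_sym x y : gadj m x y = gadj m y x.
Proof. by rewrite /gadj addnC. Qed.

Lemma gball_center r v : v \in gball m r v.
Proof. by elim: r => [|r IH] /=; rewrite inE ?IH. Qed.

Lemma gballSP r v y : reflect
  (y \in gball m r v \/ exists2 x, x \in gball m r v & gadj m x y)
  (y \in gball m r.+1 v).
Proof.
rewrite /= !inE; apply: (iffP orP) => -[H|H]; [by left|right|by left|right].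
  by case/existsP: H => x /andP[xb xy]; exists x.
by case: H => x xb xy; apply/existsP; exists x; rewrite xb.
Qed.

Lemma gball_adj r v x y : x \in gball m r v -> gadj m x y -> y \in gball m r.+1 v.
Proof. by move=> xb xy; apply/gballSP; right; exists x. Qed.

Lemma gball_trans r s u v w : u \in gball m r v -> w \in gball m s u ->
  w \in gball m (r + s) v.
Proof.
move=> ub; elim: s w => [|s IH] w; first by rewrite inE addn0 => /eqP ->.
rewrite addnS => /gballSP[/IH wb|[x /IH xb xw]]; apply/gballSP; first by left.
by right; exists x.
Qed.

Lemma gball_sym r u v : u \in gball m r v -> v \in gball m r u.
Proof.
elim: r u => [|r IH] u; first by rewrite !inE eq_sym.
case/gballSP=> [/IH vb|[x /IH vb xu]]; first by apply/gballSP; left.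
rewrite -add1n; apply: gball_trans vb.
by apply: gball_adj (gball_center 0 u) _; rewrite gadj_sym.
Qed.

Lemma gball_sub r s v : (r <= s)%N -> gball m r v \subset gball m s v.
Proof.
move=> /subnKC <-; apply/fintype.subsetP => x xb.
by apply: gball_trans xb (gball_center _ _).
Qed.

Lemma card_bigcup_leq (I T : finType) (B : {set I}) (F : I -> {set T}) :
  (#|(\bigcup_(i in B) F i)%SET| <= \sum_(i in B) #|F i|)%N.
Proof.
elim/big_rec2: _ => [|i a S _ IH]; first by rewrite cards0.
by apply: leq_trans (leq_card_setU _ _) _; rewrite leq_add2l.
Qed.

Lemma card_gball D r v : (forall x, #|[set y | gadj m x y]| <= D)%N ->
  (#|gball m r v| <= D.+1 ^ r)%N.
Proof.
move=> deg; elim: r => [|r IH]; first by rewrite cards1.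
apply: (@leq_trans (#|gball m r v| + #|gball m r v| * D)).
  apply: leq_trans (leq_card_setU _ _) _; rewrite leq_add2l.
  have -> : [set y | [exists x in gball m r v, gadj m x y]] =
      (\bigcup_(x in gball m r v) [set y | gadj m x y])%SET.
    apply/setP => y; rewrite inE; apply/existsP/bigcupP.
      by case=> x /andP[xb xy]; exists x; rewrite ?inE.
    by case=> x xb; rewrite inE => xy; exists x; rewrite xb.
  apply: leq_trans (card_bigcup_leq _ _) _.
  by rewrite -sum_nat_const; apply: leq_sum => x _; exact: deg.
by rewrite -mulnS expnSr leq_mul2r IH orbT.
Qed.

(** By symmetry of balls, such a vertex lies in the ball of radius [r] about some point of [B]. *)
Lemma card_ball_meets D r (B : {set V}) : (forall x, #|[set y | gadj m x y]| <= D)%N ->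
  (#|[set v | ~~ [disjoint gball m r v & B]]| <= #|B| * D.+1 ^ r)%N.
Proof.
move=> deg; apply: (@leq_trans #|(\bigcup_(b in B) gball m r b)%SET|).
  apply: subset_leq_card; apply/fintype.subsetP => v; rewrite inE.
  case/pred0Pn => b /andP[/= bv bB]; apply/bigcupP; exists b => //.
  exact: gball_sym.
apply: leq_trans (card_bigcup_leq _ _) _.
by rewrite -sum_nat_const; apply: leq_sum => x _; exact: card_gball.
Qed.

End Balls.

(** * Ball isomorphisms and symmetrization *)

Section BallIso.

Lemma ball_iso_trans (V W U : finType) (m : V -> V -> nat) (mW : W -> W -> nat)
    (mU : U -> U -> nat) r v w u :
  ball_iso m mW r v w -> ball_iso mW mU r w u -> ball_iso m mU r v u.
Proof.
case=> f [fv fI fB fm] [g [gw gI gB gm]]; exists (g \o f).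
have fin x : x \in gball m r v -> f x \in gball mW r w.
  by move=> xb; rewrite -fB imset_f.
split => /=; first by rewrite fv.
- by move=> x y xb yb /= /(gI _ _ (fin _ xb) (fin _ yb)); exact: fI.
- by rewrite imset_comp fB.
- by move=> x y xb yb; rewrite fm // gm ?fin.
Qed.

Lemma ball_iso_sym (V W : finType) (m : V -> V -> nat) (mW : W -> W -> nat) r v w :
  ball_iso m mW r v w -> ball_iso mW m r w v.
Proof.
case=> f [fv fI fB fm].
pose g z := odflt v [pick x | (x \in gball m r v) && (f x == z)].
have gK x : x \in gball m r v -> g (f x) = x.
  move=> xb; rewrite /g; case: pickP => [y /andP[yb /eqP fy]|/(_ x)]; first exact: fI.
  by rewrite xb eqxx.
have fP z : z \in gball mW r w -> exists2 x, x \in gball m r v & z = f x.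
  by rewrite -fB => /imsetP.
exists g; split; first by rewrite -fv gK // gball_center.
- by move=> _ _ /fP[x xb ->] /fP[y yb ->]; rewrite !gK // => ->.
- rewrite -fB -imset_comp; apply/setP => y; apply/imsetP/idP.
    by case=> x xb ->; rewrite /= gK.
  by move=> yb; exists y; rewrite //= gK.
- by move=> _ _ /fP[x xb ->] /fP[y yb ->]; rewrite !gK // fm.
Qed.

(** Loops are kept once, so that [symm] of [rauzy_arcs] unfolds to [rauzy_edges]. *)
Definition symm (V : finType) (m : V -> V -> nat) (x y : V) : nat :=
  if x == y then m x x else (m x y + m y x)%N.

Lemma gadj_symm (V : finType) (m : V -> V -> nat) : gadj (symm m) =2 gadj m.
Proof.
move=> x y; rewrite /gadj /symm eq_sym; case: eqVneq => [->|_] //=.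
by rewrite (addnC (m y x)) addnn double_gt0.
Qed.

Lemma eq_gball (V : finType) (m m' : V -> V -> nat) : gadj m =2 gadj m' ->
  forall r v, gball m r v = gball m' r v.
Proof.
move=> E; elim=> //= r IH v; rewrite IH; congr (_ :|: _); apply/setP => y.
by rewrite !inE; apply: eq_existsb => x; rewrite E.
Qed.

(** Symmetrizing does not change adjacency, hence not the balls either, and the same map serves. *)
Lemma ball_iso_symm (V W : finType) (m : V -> V -> nat) (mW : W -> W -> nat) r v w :
  ball_iso m mW r v w -> ball_iso (symm m) (symm mW) r v w.
Proof.
case=> f [fv fI fB fm]; exists f.
rewrite !(eq_gball (gadj_symm _)); split=> // x y xb yb.
by rewrite /symm (inj_in_eq fI) // !fm.
Qed.

End BallIso.

(** Arcs entering [x 0] and leaving [x r.*2] are left free, because they may lead out of the ball.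
    The last clause excludes the one such arc with both ends on the path, which is a loop when [r]
    is 0. *)
Definition line_nbhd (V : finType) (m : V -> V -> nat) (r : nat) (v : V) : Prop :=
  exists x : nat -> V, [/\ x r = v,
    {in [pred i | i <= r.*2]%N &, injective x},
    forall i, (i < r.*2)%N -> forall y, m (x i) y = (y == x i.+1) /\ m y (x i.+1) = (y == x i)
    & m (x r.*2) (x 0%N) = 0%N].

Section LineNbhd.
Variables (V : finType) (m : V -> V -> nat).

Section Path.
Variables (r : nat) (x : nat -> V).
Hypotheses (xI : {in [pred i | i <= r.*2]%N &, injective x})
  (xm : forall i, (i < r.*2)%N -> forall y, m (x i) y = (y == x i.+1) /\ m y (x i.+1) = (y == x i))
  (x0 : m (x r.*2) (x 0%N) = 0%N).

Lemma line_arcs i j : (i <= r.*2)%N -> (j <= r.*2)%N -> m (x i) (x j) = (i.+1 == j).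
Proof.
move=> ir jr; have [ir'|ir'] := ltnP i r.*2.
  by rewrite (xm ir' _).1 (inj_in_eq xI) // eq_sym.
have -> : i = r.*2 by apply/eqP; rewrite eqn_leq ir.
case: j jr => [|j] jr; first by rewrite x0.
by rewrite (xm jr _).2 (inj_in_eq xI) //= ?inE ?(ltnW jr) // eqSS.
Qed.

Lemma line_gball j : (j <= r)%N -> forall y, reflect
  (exists i, [/\ y = x i, r <= i + j & i <= r + j]%N) (y \in gball m j (x r)).
Proof.
elim: j => [|j IH] jr y.
  rewrite inE; apply: (iffP eqP) => [->|[i [-> ri ir]]]; first by exists r; rewrite addn0.
  by congr x; lia.
have {}IH := IH (ltnW jr); apply: (iffP (gballSP _ _ _ _)).
  case=> [/IH[i [-> ri ir]]|[z /IH[i [-> ri ir]] adj]]; first by exists i; split=> //; lia.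
  have ilt : (i < r.*2)%N by lia.
  (* Since [j < r], the index [i] is positive, so the arcs leaving and the arcs entering [x i] are
     both known. *)
  case: i ri ir ilt adj => [|i] ri ir ilt; first by lia.
  rewrite /gadj (xm ilt _).1 (xm (ltnW ilt) _).2.
  case: eqVneq => [-> _|_]; first by exists i.+2; split=> //; lia.
  by case: eqVneq => [-> _|_] //; exists i; split=> //; lia.
case=> i [-> ri ir].
have [/andP[h1 h2]|/nandP h] := boolP ((r <= i + j) && (i <= r + j))%N.
  by left; apply/IH; exists i.
right; have [h1|h1] := ltnP i r.
  exists (x i.+1); first by apply/IH; exists i.+1; split=> //; lia.
  by rewrite /gadj !line_arcs ?eqxx ?addn1 ?addnS //; lia.
exists (x i.-1); first by apply/IH; exists i.-1; split=> //; lia.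
by rewrite /gadj !line_arcs; try lia; rewrite prednK ?eqxx //; lia.
Qed.

End Path.

End LineNbhd.

Lemma line_nbhd_iso (V : finType) (m : V -> V -> nat) (W : finType) (mW : W -> W -> nat) r v w :
  line_nbhd m r v -> line_nbhd mW r w -> ball_iso m mW r v w.
Proof.
case=> x [<- xI xm x0] [z [<- zI zm z0]].
(* The value [z r] off the path is arbitrary. *)
pose f y := if [pick i : 'I_r.*2.+1 | y == x i] is Some i then z i else z r.
have fx i : (i <= r.*2)%N -> f (x i) = z i.
  move=> ir; rewrite /f; case: pickP => [j /eqP E|/(_ (Ordinal (ir : (i < r.*2.+1)%N)))] /=.
    by rewrite (xI _ _ _ _ E) // inE -ltnS.
  by rewrite eqxx.
have xb := line_gball xI xm x0 (leqnn r).
have zb := line_gball zI zm z0 (leqnn r).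
have xP y : y \in gball m r (x r) -> exists2 i, (i <= r.*2)%N & y = x i.
  by move=> /xb[i [-> _ ir]]; exists i => //; lia.
exists f; split.
- by rewrite fx //; lia.
- by move=> _ _ /xP[i ir ->] /xP[j jr ->]; rewrite !fx // => /zI -> //.
- apply/setP => y; apply/imsetP/idP.
    by case=> _ /xP[i ir ->] ->; rewrite fx //; apply/zb; exists i; split=> //; lia.
  case/zb => i [-> ri ir]; exists (x i); last by rewrite fx //; lia.
  by apply/xb; exists i; split=> //; lia.
- by move=> _ _ /xP[i ir ->] /xP[j jr ->]; rewrite !fx // (line_arcs xI xm x0) // (line_arcs zI zm z0).
Qed.

(** * Vertices with exactly one arc in and one arc out *)

Section GoodVertices.
Variables (V : finType) (m : V -> V -> nat).

Definition good_vertex x := (\sum_y m x y == 1)%N && (\sum_y m y x == 1)%N.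

Lemma sum_nat_unique (F : V -> nat) : (\sum_y F y = 1)%N -> exists z, forall y, F y = (y == z).
Proof.
move=> F1; have [z Fz] : exists z, (0 < F z)%N.
  apply/existsP; apply: contra_eqT F1; rewrite negb_exists => /forallP F0.
  by rewrite big1 // => i _; apply/eqP; rewrite -leqn0 leqNgt.
exists z => y; move: F1; rewrite (bigD1 z) //=; case: eqVneq => [->|yz]; first by lia.
by rewrite (bigD1 y) //=; lia.
Qed.

(** Unique successors and predecessors are followed [r] steps each way from [v]. A repeated vertex
    would close a walk of length at most [r.*2], and an arc from the last vertex to the first one of
    length [r.*2.+1]; hence the bound on [l]. *)
Lemma line_of_good r v :
  (forall x, x \in gball m r v -> good_vertex x) ->
  (forall x l (w : nat -> V), x \in gball m r v -> (0 < l <= r.*2.+1)%N ->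
     w 0%N = x -> (forall i, (i < l)%N -> (0 < m (w i) (w i.+1))%N) -> w l <> x) ->
  line_nbhd m r v.
Proof.
move=> gd nocyc.
(* Outside the ball the chosen neighbour is a dummy, so that [s] and [t] become total functions. *)
have sE : forall x, exists y, x \in gball m r v -> forall z, m x z = (z == y).
  move=> x; case xb: (x \in gball m r v); last by exists x.
  by have /andP[/eqP/sum_nat_unique[y yE] _] := gd _ xb; exists y.
have tE : forall x, exists y, x \in gball m r v -> forall z, m z x = (z == y).
  move=> x; case xb: (x \in gball m r v); last by exists x.
  by have /andP[_ /eqP/sum_nat_unique[y yE]] := gd _ xb; exists y.
have [s {}sE] := choice sE; have [t {}tE] := choice tE.
have sb i : (i <= r)%N -> iter i s v \in gball m i v.
  elim: i => [|i IH] ir; first by rewrite inE.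
  have ib := IH (ltnW ir); apply: (gball_adj ib).
  rewrite /gadj /= sE ?eqxx //; exact: (fintype.subsetP (gball_sub m v (ltnW ir)) _ ib).
have tb i : (i <= r)%N -> iter i t v \in gball m i v.
  elim: i => [|i IH] ir; first by rewrite inE.
  have ib := IH (ltnW ir); apply: (gball_adj ib).
  by rewrite /gadj /= (tE _ (fintype.subsetP (gball_sub m v (ltnW ir)) _ ib)) eqxx addn1.
pose x i := if (i <= r)%N then iter (r - i) t v else iter (i - r) s v.
have xb i : (i <= r.*2)%N -> x i \in gball m r v.
  move=> ir; rewrite /x; case: leqP => h.
    by apply: (fintype.subsetP (gball_sub m v (leq_subr i r)) _ (tb _ _)); lia.
  have h' : (i - r <= r)%N by lia.
  exact: (fintype.subsetP (gball_sub m v h') _ (sb _ h')).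
have x1 i : (i < r.*2)%N -> m (x i) (x i.+1) = 1%N.
  move=> ir; have := xb _ ir; have := xb _ (ltnW ir); rewrite /x.
  case: (ltngtP i r) => h h1 h2.
  - rewrite tE //; have -> : (r - i = (r - i.+1).+1)%N by lia.
    by rewrite iterS eqxx.
  - by rewrite sE // subSn 1?ltnW //= eqxx.
  - by rewrite h subnn /= subSnn /= sE ?eqxx // gball_center.
exists x; split.
- by rewrite /x leqnn subnn.
- suff H i j : (i < j)%N -> (j <= r.*2)%N -> x i <> x j.
    move=> i j; rewrite !inE => ir jr E; case: (ltngtP i j) => // h; first by case: (H _ _ h).
    by case: (H _ _ h ir).
  move=> ij jr E; apply: (nocyc (x i) (j - i)%N (fun l => x (i + l)%N)); last 1 first.
  + by rewrite subnKC // ltnW.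
  + by apply: xb; lia.
  + by lia.
  + by rewrite addn0.
  + by move=> l lj; rewrite addnS x1 //; lia.
- move=> i ir y; have E := x1 i ir; split.
    move: E; rewrite !sE ?xb 1?ltnW //; by case: (x i.+1 =P _) => // ->.
  by move: E; rewrite !tE ?xb //; case: (x i =P _) => // ->.
- apply/eqP; rewrite -leqn0 leqNgt; apply/negP => h.
  apply: (nocyc (x 0%N) r.*2.+1 (fun l => if (l <= r.*2)%N then x l else x 0%N)) => //.
  + exact: xb.
  + by rewrite ltn0Sn leqnn.
  + move=> i; rewrite ltnS => ir; rewrite ir /=; case: (ltnP i r.*2) => h2; first by rewrite x1.
    by have -> : i = r.*2 by lia.
  + by rewrite ltnn.
Qed.

End GoodVertices.

Lemma dZline_nbhd r : line_nbhd (@dZline r) r (Zroot r).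
Proof.
exists (fun i => inord i); split=> //.
- by move=> i j; rewrite !inE => ir jr /(congr1 val); rewrite /= !inordK.
- move=> i ir y.
  have [h1 h2] : (i < r.*2.+1)%N /\ (i.+1 < r.*2.+1)%N by split; lia.
  rewrite /dZline (inordK h1) (inordK h2) eqSS; split; congr nat_of_bool.
    by apply/eqP/eqP => [E|->]; [apply: val_inj; rewrite /= inordK|rewrite inordK].
  by apply/eqP/eqP => [E|->]; [apply: val_inj; rewrite /= inordK|rewrite inordK].
- by rewrite /dZline !inordK.
Qed.

Lemma Zline_symm r : @Zline r = symm (@dZline r).
Proof.
apply/funext => i; apply/funext => j; rewrite /Zline /symm /dZline.
case: (eqVneq i j) => [->|ij]; first by rewrite orbb.
by case: eqP => [h1|h1]; case: eqP => [h2|h2] //=; lia.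
Qed.

(** * Counting in Rauzy graphs *)

Lemma card_cset (T : finType) (P : pred T) : #|[set x : T | P x]%classic| = #|P|.
Proof. by apply: eq_card => x; apply/idP/idP => [/set_mem|H] //; apply/mem_set. Qed.

Section Language.
Variables (A : finType) (L : pred (seq A)).
Hypotheses (HA : (1 < #|A|)%N) (Hfact : factorial_lang L)
  (Hunb : unbounded_complexity L).

Notation p := (complexity L).
Notation W := (Lw L).
Notation word x := (tval (val x)).

Lemma word_inj n : injective (fun x : W n => word x).
Proof. by move=> x y /val_inj/val_inj. Qed.

Lemma size_word n (x : W n) : size (word x) = n.
Proof. exact: size_tuple. Qed.

Definition mkword n s (hs : size s == n) (hL : L s) : W n :=
  exist (fun t : n.-tuple A => L t) (Tuple hs) hL.

Lemma L_take n s : L s -> L (take n s).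
Proof. by move=> h; apply: (Hfact (u := [::]) (v := drop n s)); rewrite /= cat_take_drop. Qed.

Lemma L_drop n s : L s -> L (drop n s).
Proof. by move=> h; apply: (Hfact (u := take n s) (v := [::])); rewrite cats0 cat_take_drop. Qed.

Lemma prefix_size n (w : W n.+1) : size (take n (word w)) == n.
Proof. by rewrite size_take size_word ltnSn. Qed.

Lemma suffix_size n (w : W n.+1) : size (drop 1 (word w)) == n.
Proof. by rewrite size_drop size_word subn1. Qed.

Definition prefix_word n (w : W n.+1) : W n := mkword (prefix_size w) (L_take n (valP w)).
Definition suffix_word n (w : W n.+1) : W n := mkword (suffix_size w) (L_drop 1 (valP w)).

Lemma rauzy_arcsE n (x y : W n) :
  (rauzy_arcs x y = \sum_w ((prefix_word w == x) && (suffix_word w == y)))%N.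
Proof.
rewrite /rauzy_arcs card_cset -sum1_card big_mkcond /=; apply: eq_bigr => w _.
by rewrite -!(inj_eq (@word_inj n)) /= unfold_in /=; case: (_ && _).
Qed.

Lemma outdegE n (x : W n) : (\sum_y rauzy_arcs x y = #|[pred w | prefix_word w == x]|)%N.
Proof.
under eq_bigr do rewrite rauzy_arcsE.
rewrite exchange_big /= -sum1_card [RHS]big_mkcond /=; apply: eq_bigr => w _.
rewrite (bigD1 (suffix_word w)) //= eqxx andbT big1 ?addn0 ?inE; first by case: (_ == _).
by move=> y /negPf; rewrite eq_sym => ->; rewrite andbF.
Qed.

Lemma indegE n (y : W n) : (\sum_x rauzy_arcs x y = #|[pred w | suffix_word w == y]|)%N.
Proof.
under eq_bigr do rewrite rauzy_arcsE.
rewrite exchange_big /= -sum1_card [RHS]big_mkcond /=; apply: eq_bigr => w _.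
rewrite (bigD1 (prefix_word w)) //= eqxx big1 ?addn0 ?inE; first by case: (_ == _).
by move=> x /negPf; rewrite eq_sym => ->.
Qed.

Lemma sum_card_fibers (T U : finType) (f : T -> U) : (\sum_y #|[pred x | f x == y]| = #|T|)%N.
Proof.
rewrite -sum1_card (partition_big f predT) //=; apply: eq_bigr => y _.
by rewrite -sum1_card; apply: eq_bigl => x; rewrite inE.
Qed.

Lemma sum_outdeg n : (\sum_(x : W n) \sum_y rauzy_arcs x y = p n.+1)%N.
Proof. by under eq_bigr do rewrite outdegE; rewrite sum_card_fibers. Qed.

Lemma sum_indeg n : (\sum_(y : W n) \sum_x rauzy_arcs x y = p n.+1)%N.
Proof. by under eq_bigr do rewrite indegE; rewrite sum_card_fibers. Qed.

Let a0 : A.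
Proof. by have /card_gt0P/sigW[a _] : (0 < #|A|)%N by exact: ltnW. Qed.

Lemma outdeg_le n (x : W n) : (\sum_y rauzy_arcs x y <= #|A|)%N.
Proof.
rewrite outdegE -(card_in_imset (f := fun w : W n.+1 => nth a0 (word w) n)).
  exact: max_card.
move=> w w'; rewrite !inE => /eqP <- /eqP E /= Ew; apply: word_inj.
have E' : take n (word w') = take n (word w) by have /(congr1 (fun z => word z)) := E.
apply: (@eq_from_nth _ a0); rewrite !size_word // => i; rewrite ltnS leq_eqVlt.
by case/predU1P => [->|/= ip]; rewrite // -(nth_take a0 ip) -E' nth_take.
Qed.

Lemma indeg_le n (y : W n) : (\sum_x rauzy_arcs x y <= #|A|)%N.
Proof.
rewrite indegE -(card_in_imset (f := fun w : W n.+1 => nth a0 (word w) 0)).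
  exact: max_card.
move=> w w'; rewrite !inE => /eqP <- /eqP E /= Ew; apply: word_inj.
have E' : drop 1 (word w') = drop 1 (word w) by have /(congr1 (fun z => word z)) := E.
apply: (@eq_from_nth _ a0); rewrite !size_word // => -[_|i ip] //.
by rewrite -[i.+1]add1n -!nth_drop E'.
Qed.

Lemma card_pos_le_sum (T : finType) (F : T -> nat) : (#|[pred y | 0 < F y]| <= \sum_y F y)%N.
Proof.
rewrite -sum1_card big_mkcond; apply: leq_sum => y _.
by rewrite inE; case: (F y).
Qed.

Lemma degree_le n (x : W n) : (#|[set y | gadj (@rauzy_arcs A L n) x y]| <= #|A|.*2)%N.
Proof.
have -> : [set y | gadj (@rauzy_arcs A L n) x y] =
    [set y | 0 < rauzy_arcs x y]%N :|: [set y | 0 < rauzy_arcs y x]%N.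
  by apply/setP => y; rewrite !inE /gadj addn_gt0.
apply: leq_trans (leq_card_setU _ _) _; rewrite -addnn !cardsE.
apply: leq_add; first exact: leq_trans (card_pos_le_sum _) (outdeg_le x).
exact: leq_trans (card_pos_le_sum _) (indeg_le x).
Qed.

Lemma complexity_le n : (p n <= #|A| ^ n)%N.
Proof. by rewrite -card_tuple; exact: leq_card val_inj. Qed.

(** As [p n] is at most [#|A| ^ n], large complexity forces long words, whose prefixes have every
    smaller length. *)
Lemma complexity_gt0 n : (0 < p n)%N.
Proof.
have [N HN] := Hunb (#|A| ^ n)%N.
have nN : (n <= N)%N.
  by rewrite -(leq_exp2l _ _ HA) ltnW //; exact: leq_trans HN (complexity_le N).
have /card_gt0P[w _] : (0 < p N)%N by exact: leq_ltn_trans HN.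
apply/card_gt0P; unshelve eexists; first apply: (@mkword n (take n (word w))).
- by rewrite size_takel // size_word.
- exact: L_take (valP w).
- by [].
Qed.

Definition left_dead n := #|[pred x : W n | ~~ left_prolongable L (word x)]|.
Definition right_dead n := #|[pred x : W n | ~~ right_prolongable L (word x)]|.

Lemma right_prolongable_outdeg n (x : W n) :
  right_prolongable L (word x) -> (0 < \sum_y rauzy_arcs x y)%N.
Proof.
case/existsP => a La; rewrite outdegE; apply/card_gt0P.
have sz : size (rcons (word x) a) == n.+1 by rewrite size_rcons size_word.
exists (mkword sz La); rewrite inE; apply/eqP; apply: word_inj.
by rewrite /= -cats1 take_size_cat ?size_word.
Qed.

Lemma left_prolongable_indeg n (x : W n) :
  left_prolongable L (word x) -> (0 < \sum_y rauzy_arcs y x)%N.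
Proof.
case/existsP => a La; rewrite indegE; apply/card_gt0P.
have sz : size (a :: word x) == n.+1 by rewrite /= size_word.
exists (mkword sz La); rewrite inE; apply/eqP; apply: word_inj.
by rewrite /= drop0.
Qed.

(* Each vertex of degree d contributes d - 1 >= [d <> 1] - 2 [d = 0]. *)
Lemma card_degree_neq1 (T : finType) (d : T -> nat) :
  (#|[pred x | d x != 1]| + #|T| <= \sum_x d x + #|[pred x | d x == 0]|.*2)%N.
Proof.
rewrite -!sum1_card [X in (X + _)%N]big_mkcond [X in X.*2]big_mkcond -!addnn.
by rewrite -!big_split; apply: leq_sum => x _ /=; rewrite !inE; case: (d x) => [|[|]].
Qed.

(** Both degree sums equal p(n+1), and vertices of out-degree or in-degree zero are among the words
    that are not prolongable on that side. *)
Lemma card_not_good n :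
  (#|[pred x : W n | ~~ good_vertex (@rauzy_arcs A L n) x]| + (p n).*2 <=
   (p n.+1).*2 + (left_dead n).*2 + (right_dead n).*2)%N.
Proof.
have Ho := @card_degree_neq1 (W n) (fun x => \sum_y rauzy_arcs x y)%N.
have Hi := @card_degree_neq1 (W n) (fun x => \sum_y rauzy_arcs y x)%N.
rewrite sum_outdeg -/(p n) in Ho; rewrite sum_indeg -/(p n) in Hi.
have ho : (#|[pred x : W n | \sum_y rauzy_arcs x y == 0]| <= right_dead n)%N.
  apply: subset_leq_card; apply/fintype.subsetP => x; rewrite !inE => h.
  by apply: contraL h => /right_prolongable_outdeg; rewrite lt0n.
have hi : (#|[pred x : W n | \sum_y rauzy_arcs y x == 0]| <= left_dead n)%N.
  apply: subset_leq_card; apply/fintype.subsetP => x; rewrite !inE => h.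
  by apply: contraL h => /left_prolongable_indeg; rewrite lt0n.
have : (#|[pred x : W n | ~~ good_vertex (@rauzy_arcs A L n) x]| <=
    #|[pred x : W n | \sum_y rauzy_arcs x y != 1]| +
    #|[pred x : W n | \sum_y rauzy_arcs y x != 1]|)%N.
  rewrite -cardUI; apply: leq_trans (leq_addr _ _); apply: subset_leq_card.
  by apply/fintype.subsetP => x; rewrite !inE negb_and.
lia.
Qed.

Lemma rauzy_arc_nth n (x y : W n) i : (0 < rauzy_arcs x y)%N -> (i.+1 < n)%N ->
  nth a0 (word x) i.+1 = nth a0 (word y) i.
Proof.
rewrite /rauzy_arcs card_cset => /card_gt0P[w /andP[/eqP <- /eqP <-]] ip.
by rewrite nth_take // nth_drop.
Qed.

Definition periodic n l : {set W n} := [set x : W n |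
  [forall i : 'I_n, (i + l < n)%N ==> (nth a0 (word x) (i + l) == nth a0 (word x) i)]].

(** An arc shifts a word by one letter, so along [l] arcs the letter at [i + l] moves to position
    [i]. *)
Lemma closed_walk_periodic n (w : nat -> W n) l :
  (forall i, (i < l)%N -> (0 < rauzy_arcs (w i) (w i.+1))%N) -> w l = w 0%N ->
  w 0%N \in periodic n l.
Proof.
move=> ww wl; rewrite inE; apply/forallP => i; apply/implyP => il; apply/eqP.
rewrite -[in RHS]wl; move: (nat_of_ord i) il => {wl}{}i.
elim: l i ww => [|l IH] i ww il; first by rewrite addn0.
rewrite addnS -addSn IH; [|by move=> j jl; apply: ww; exact: ltnW|by rewrite addSnnS].
by rewrite (@rauzy_arc_nth n (w l) (w l.+1)) ?ww //; lia.
Qed.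

(** A word of period [l] is determined by its first [l] letters, which makes the bound independent
    of [n]. *)
Lemma card_periodic n l : (0 < l)%N -> (#|periodic n l| <= #|A| ^ l)%N.
Proof.
move=> l0; rewrite -[in leqRHS](card_ord l) -card_ffun.
rewrite -(card_in_imset (f := fun x : W n => [ffun j : 'I_l => nth a0 (word x) j])).
  exact: max_card.
move=> x y; rewrite !inE => /forallP px /forallP py E; apply: word_inj.
apply: (@eq_from_nth _ a0); rewrite !size_word // => i.
have [m] := ubnP i; elim: m i => // m IH i im ip.
have [il|il] := ltnP i l.
  by have /ffunP/(_ (Ordinal il)) := E; rewrite !ffunE.
have iln : (i - l < n)%N by lia.
have e : (Ordinal iln + l = i)%N by rewrite /= subnK.
have := px (Ordinal iln); have := py (Ordinal iln); rewrite e ip /= => /eqP -> /eqP ->.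
by apply: IH => //; lia.
Qed.

Definition ball_const r := ((#|A|.*2).+1 ^ r)%N.
(** Bounds the number of words with a period from 1 to [r.*2.+1], the walk lengths to be excluded
    around a line; the summand at 0 is harmless slack. *)
Definition period_const r := (\sum_(l < r.*2.+2) #|A| ^ l)%N.

(** A vertex without line neighbourhood has a vertex of wrong degree or of short period in its ball,
    and each of these spoils at most [ball_const r] vertices. Terms are placed so as to avoid
    truncated subtraction. *)
Lemma card_not_line n r :
  (#|[pred x : W n | ~~ `[< line_nbhd (@rauzy_arcs A L n) r x >]]| +
   ball_const r * (p n).*2 <=
   ball_const r * ((p n.+1).*2 + (left_dead n).*2 + (right_dead n).*2 + period_const r))%N.
Proof.
pose G := [set x : W n | ~~ good_vertex (@rauzy_arcs A L n) x].
pose P := (\bigcup_(l in [set l : 'I_r.*2.+2 | 0 < l]%N) periodic n l)%SET.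
have cP : (#|P| <= period_const r)%N.
  apply: leq_trans (card_bigcup_leq _ _) _; rewrite big_mkcond /=.
  by apply: leq_sum => l _; rewrite inE; case: posnP => // /card_periodic.
have cG : (#|G| + (p n).*2 <= (p n.+1).*2 + (left_dead n).*2 + (right_dead n).*2)%N.
  by rewrite cardsE; exact: card_not_good.
have : (#|[pred x : W n | ~~ `[< line_nbhd (@rauzy_arcs A L n) r x >]]| <=
    #|G :|: P| * ball_const r)%N.
  apply: leq_trans (card_ball_meets r (G :|: P) (@degree_le n)).
  apply: subset_leq_card; apply/fintype.subsetP => x; rewrite !inE; apply: contra.
  move=> /pred0P dis0.
  have dis y : y \in gball (@rauzy_arcs A L n) r x -> y \notin G :|: P.
    by move=> yb; have /= := dis0 y; rewrite yb /= => ->.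
  apply/asboolP; apply: line_of_good.
    by move=> y /dis; rewrite !inE negb_or negbK => /andP[].
  move=> y l w yb l1 w0 ww wl; have := dis _ yb; rewrite inE => /norP[_] /negP; apply.
  have ll : (l < r.*2.+2)%N by lia.
  apply/bigcupP; exists (Ordinal ll); first by rewrite inE; case/andP: l1.
  by rewrite -w0; apply: closed_walk_periodic; rewrite // w0.
move=> h; apply: (@leq_trans (ball_const r * (#|G :|: P| + (p n).*2))).
  by rewrite mulnDr leq_add2r mulnC.
rewrite leq_mul2l; apply/orP; right.
have := (leq_card_setU G P).1; lia.
Qed.

(** Morse-Hedlund argument: otherwise each word of length [n] has exactly one right extension, so
    the complexity never again exceeds [p n], against unboundedness. *)
Lemma complexity_succ_lt n :
  (forall x : W n, right_prolongable L (word x)) -> (p n < p n.+1)%N.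
Proof.
move=> rp; rewrite ltnNge; apply/negP => le.
have outpos (x : W n) : (0 < #|[pred w : W n.+1 | prefix_word w == x]|)%N.
  by rewrite -outdegE; exact: right_prolongable_outdeg.
have out1 (x : W n) : #|[pred w : W n.+1 | prefix_word w == x]| = 1%N.
  apply/eqP; rewrite eqn_leq outpos andbT leqNgt; apply/negP => x2.
  have : (\sum_(y : W n) 1 < \sum_(y : W n) #|[pred w : W n.+1 | prefix_word w == y]|)%N.
    rewrite (bigD1 x) //= [ltnRHS](bigD1 x) //=.
    by apply: (@leq_add 2) => //; apply: leq_sum => y _; exact: outpos.
  by rewrite sum1_card sum_card_fibers ltnNge le.
have pI : injective (@prefix_word n).
  move=> w w' E; have /eqP/card1P[z zP] := out1 (prefix_word w).
  have := zP w; have := zP w'; rewrite !inE E eqxx.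
  by move=> /esym/eqP -> /esym/eqP ->.
(* In a longer word, the last letter is already determined by the [n] letters before it. *)
have pnS l : (n <= l)%N -> (p l.+1 <= p n)%N.
  move=> /subnKC <-; elim: (l - n)%N => [|j IH]; first by rewrite addn0.
  apply: leq_trans IH; rewrite addnS; apply: (leq_card (@prefix_word (n + j).+1)).
  move=> w w' E; apply: word_inj.
  have tE : take (n + j).+1 (word w) = take (n + j).+1 (word w').
    by have /(congr1 (fun z => word z)) := E.
  have sz (u : W (n + j).+2) : size (drop j.+1 (word u)) == n.+1.
    by rewrite size_drop size_word; apply/eqP; lia.
  have /pI/(congr1 (fun z => word z)) /= dE :
      prefix_word (mkword (sz w) (L_drop _ (valP w))) =
      prefix_word (mkword (sz w') (L_drop _ (valP w'))).
    apply: word_inj => /=; have := congr1 (drop j.+1) tE.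
    by rewrite !take_drop addnS.
  rewrite -(cat_take_drop j.+1 (word w)) -(cat_take_drop j.+1 (word w')) dE.
  congr (_ ++ _); have := congr1 (take j.+1) tE.
  by rewrite !take_takel // ltnS leq_addl.
have [N HN] := Hunb (\max_(i < n.+1) p i).
have [Nn|nN] := leqP N n.
  by have := leq_bigmax (F := fun i : 'I_n.+1 => p i) (Ordinal (Nn : (N < n.+1)%N)); rewrite leqNgt HN.
have := pnS N.-1; rewrite prednK; last by lia.
move=> /(_ _)/wrap[]; first by lia.
apply/negP; rewrite -ltnNge; apply: leq_ltn_trans HN.
exact: (leq_bigmax (F := fun i : 'I_n.+1 => p i) ord_max).
Qed.

Lemma complexity_succ_ge n : (p n <= p n.+1 + right_dead n)%N.
Proof.
rewrite -sum_outdeg -[p n]sum1_card /right_dead -sum1_card [X in (_ <= _ + X)%N]big_mkcond.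
rewrite -big_split /=; apply: leq_sum => x _; rewrite inE.
case: (boolP (right_prolongable L (word x))) => [/right_prolongable_outdeg h|_] /=; first by rewrite addn0.
by rewrite addn1.
Qed.

(** Where the complexity is at most [C], it has been strictly increasing, and this can last for at
    most [C] steps backwards. *)
Lemma complexity_unbounded C N :
  (forall n, (N <= n)%N -> ((2 * C + 2) * right_dead n < p n)%N) ->
  forall n, (N + C < n)%N -> (C < p n)%N.
Proof.
move=> HN.
have H n : (N <= n)%N -> (p n.+1 <= C)%N -> (p n < p n.+1)%N.
  move=> Nn pC; apply: complexity_succ_lt => x.
  (* With [d] = [right_dead n], one has (2C+2) d < p(n) <= C + d, which forces d = 0. *)
  have := complexity_succ_ge n; have := HN _ Nn; case E: (right_dead n) => [|d]; last by nia.
  by move=> _ _; have := card0_eq E x; rewrite inE => /negbFE.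
move=> n Nn; rewrite ltnNge; apply/negP => pC.
have K j : (j <= C.+1)%N -> (p (n - j) + j <= C)%N.
  elim: j => [|j IH] jC; first by rewrite subn0 addn0.
  have IH' := IH (ltnW jC).
  have e : (n - j = (n - j.+1).+1)%N by lia.
  have := @H (n - j.+1)%N; rewrite -e; lia.
have := K C.+1 (leqnn _); lia.
Qed.

(* Non-loop arcs are counted twice; loops come from constant words. *)
Lemma sum_edges n : (0 < n)%N ->
  ((p n.+1).*2 <= \sum_(x : W n) \sum_y rauzy_edges x y + #|A|)%N.
Proof.
move=> n0.
have E (x y : W n) : (rauzy_edges x y + (if x == y then rauzy_arcs x x else 0) =
    rauzy_arcs x y + rauzy_arcs y x)%N.
  by rewrite /rauzy_edges; case: eqVneq => [->|] //; rewrite addn0.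
have : (\sum_(x : W n) \sum_y (rauzy_edges x y + (if x == y then rauzy_arcs x x else 0)) =
    (p n.+1).*2)%N.
  under eq_bigr do under eq_bigr do rewrite E.
  under eq_bigr do rewrite big_split /=.
  by rewrite big_split /= sum_outdeg exchange_big /= sum_outdeg addnn.
under eq_bigr do rewrite big_split /=.
rewrite big_split /= => <-; rewrite leq_add2l.
have -> : (\sum_(x : W n) \sum_y (if x == y then rauzy_arcs x x else 0) =
    \sum_(x : W n) rauzy_arcs x x)%N.
  apply: eq_bigr => x _; rewrite (bigD1 x) //= eqxx big1 ?addn0 // => y /negPf.
  by rewrite eq_sym => ->.
have -> : #|A| = (#|A| ^ 1)%N by rewrite expn1.
apply: leq_trans (@card_periodic n 1 isT).
rewrite -sum1_card [leqRHS]big_mkcond /=; apply: leq_sum => x _.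
(* For [n > 0] a word of length [n.+1] is determined by its prefix and suffix of length [n]. *)
have x1 : (rauzy_arcs x x <= 1)%N.
  rewrite /rauzy_arcs card_cset; apply/card_le1P => w /andP[/eqP w1 /eqP w2] w'.
  rewrite !inE; apply/andP/eqP => [[/eqP w1' /eqP w2']|->]; last by rewrite w1 w2 !eqxx.
  apply: word_inj; apply: (@eq_from_nth _ a0); rewrite !size_word // => -[|i] ip.
    by rewrite -(nth_take a0 n0) w1' -w1 nth_take.
  by rewrite -[i.+1]add1n -!nth_drop w2 w2'.
case: (posnP (rauzy_arcs x x)) => [->//|xx].
suff -> : x \in periodic n 1 by [].
by apply: (@closed_walk_periodic n (fun=> x)).
Qed.

End Language.

Local Open Scope classical_set_scope.
Local Open Scope ring_scope.

(** * Spectra of real symmetric matrices *)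

Lemma char_poly_similar (F : fieldType) (n : nat) (P D : 'M[F]_n) :
  P \in unitmx -> char_poly (invmx P *m D *m P) = char_poly D.
Proof.
move=> Pu; set Q := map_mx polyC P; set Q' := map_mx polyC (invmx P).
have QQ : Q' *m Q = 1%:M by rewrite -map_mxM mulVmx // map_mx1.
have E : char_poly_mx (invmx P *m D *m P) = Q' *m char_poly_mx D *m Q.
  rewrite /char_poly_mx mulmxBr mulmxBl !map_mxM /= -/Q -/Q'.
  by congr (_ - _); rewrite scalar_mxC -mulmxA QQ mulmx1.
rewrite /char_poly E !det_mulmx mulrC mulrA -det_mulmx mulmx1C //.
by rewrite det1 mul1r.
Qed.

(** Over the complex numbers the matrix is Hermitian, hence diagonalizable with real eigenvalues,
    and both identities descend along the injection of [R]. The trace formula reduces spectral sums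
    to diagonal entries. *)
Lemma real_spectrum (R : realType) (n : nat) (A : 'M[R]_n.+1) :
  A^T = A -> exists s : seq R, [/\ size s = n.+1,
    char_poly A = \prod_(x <- s) ('X - x%:P) &
    forall p : {poly R}, \tr (horner_mx A p) = \sum_(x <- s) p.[x]].
Proof.
move=> Asym; pose c := real_complex R; pose B := map_mx c A.
have Breal : B \is a mxOver Num.real.
  by apply/mxOverP => i j; rewrite mxE; apply/complex_realP; exists (A i j).
have Bherm : B \is hermsymmx.
  apply: realsym_hermsym => //; apply/is_hermitianmxP.
  by rewrite expr0 scale1r map_mx_id // map_trmx Asym.
have /orthomx_spectralP := hermitian_normalmx Bherm.
have /mxOverP := hermitian_spectral_diag_real Bherm.
have := spectral_unit B.
move: (spectralmx B) (spectral_diag B) => P d Pu dreal BE.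
pose s := [seq complex.Re (d 0 i) | i <- enum 'I_n.+1].
have dE i : d 0 i = c (complex.Re (d 0 i)) by rewrite /c /= RRe_real.
exists s; split.
- by rewrite size_map size_enum_ord.
- apply: (map_poly_inj c); rewrite map_char_poly -/B BE char_poly_similar //.
  rewrite char_poly_trig; last exact/diag_mx_is_trig.
  rewrite rmorph_prod big_map big_enum /=; apply: eq_bigr => i _.
  by rewrite map_polyXsubC mxE eqxx mulr1n [in LHS]dE.
- move=> p; apply: (@complexI R).
  rewrite -[LHS]trace_map_mx map_horner_mx -/B BE horner_mx_uconjC //.
  rewrite mxtrace_mulC mulmxA mulmxV // mul1mx horner_mx_diag mxtrace_diag.
  rewrite rmorph_sum big_map big_enum /=; apply: eq_bigr => i _.
  by rewrite mxE dE horner_map.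
Qed.

Lemma spectral_integral_sum (R : realType) (N : nat) (M : 'M[R]_N) (s : seq R) f :
  char_poly M = \prod_(x <- s) ('X - x%:P) ->
  spectral_integral M f = N%:R^-1 * \sum_(x <- s) f x.
Proof.
move=> E; rewrite /spectral_integral E; congr (_ * _).
have -> : [set x : R | root (\prod_(y <- s) ('X - y%:P)) x] = [set` undup s].
  by apply/seteqP; split => x /=; rewrite root_prod_XsubC mem_undup.
rewrite -fsbig_seq ?undup_uniq //.
rewrite -[RHS]big_undup_iterop_count. apply: eq_bigr => x _.
by rewrite mu_prod_XsubC mulr_natl.
Qed.

(** * Ratio of complexities and Benjamini-Schramm limits *)

Section Limits.
Variable R : realType.

(* Eventual smallness along one cofinal set of indices identifies a limit. *)
Lemma cvg_frequently (u : nat -> R) (l c : R) :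
  (u @ \oo --> l)%classic ->
  (forall e N, 0 < e -> exists2 n, (N <= n)%N & `|u n - c| <= e) -> l = c.
Proof.
move=> ul uc; apply/eqP; rewrite -subr_eq0 -normr_eq0; apply/eqP.
apply/le_anti; rewrite normr_ge0 andbT; apply/ler_addgt0Pr => e e0; rewrite add0r.
have e20 : 0 < e / 2 by lra.
have /cvgrPdist_le/(_ _ e20)[N _ HN] := ul.
have [n Nn un] := uc _ N e20.
have /= := HN n Nn; move: un; rewrite !ler_norml => /andP[? ?] /andP[? ?].
by apply/andP; split; lra.
Qed.

End Limits.

Section LanguageLimits.
Variables (R : realType) (A : finType) (L : pred (seq A)).
Hypotheses (HA : (1 < #|A|)%N) (Hfact : factorial_lang L)
  (Hprol : almost_prolongable L R) (Hunb : unbounded_complexity L).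

Notation p := (complexity L).
Notation W := (Lw L).
Notation word x := (tval (val x)).

Let p0 n : (0 : R) < (p n)%:R.
Proof. by rewrite ltr0n; exact: complexity_gt0. Qed.

Lemma card_small (P : forall n, pred (W n)) :
  ((fun n => #|[pred x | P n x]|%:R / (p n)%:R : R) @ \oo --> (1 : R))%classic ->
  forall e : R, 0 < e -> \forall n \near \oo, #|[pred x | ~~ P n x]|%:R <= e * (p n)%:R.
Proof.
move=> Pn e e0; have /cvgrPdist_le/(_ _ e0) := Pn; apply: filterS => n /=.
have E : #|[pred x | P n x]|%:R + #|[pred x | ~~ P n x]|%:R = (p n)%:R :> R.
  by rewrite -natrD /complexity -(cardC (P n)); congr (_ + _)%:R; apply: eq_card.
rewrite -ler_pdivrMr // ler_norml => /andP[_]; rewrite -[X in X - _](divff (lt0r_neq0 (p0 n))).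
by rewrite -mulrBl -E addrAC subrr add0r.
Qed.

Lemma right_dead_small (e : R) : 0 < e ->
  \forall n \near \oo, (right_dead L n)%:R <= e * (p n)%:R.
Proof.
move=> e0; apply: (card_small (P := fun n x => right_prolongable L (word x))) => //.
by have := Hprol.2; under eq_fun do rewrite card_cset.
Qed.

Lemma left_dead_small (e : R) : 0 < e ->
  \forall n \near \oo, (left_dead L n)%:R <= e * (p n)%:R.
Proof.
move=> e0; apply: (card_small (P := fun n x => left_prolongable L (word x))) => //.
by have := Hprol.1; under eq_fun do rewrite card_cset.
Qed.

(** This is what absorbs the bounded corrections due to short periods and loops. *)
Lemma complexity_near C : \forall n \near \oo, (C < p n)%N.
Proof.
(* The constant 2C+3 instead of 2C+2 gives the strict inequality, as [p j] is positive. *)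
have e0 : (0 : R) < (2 * C + 3)%:R^-1 by rewrite invr_gt0 ltr0n addn3.
have [N _ HN] := right_dead_small e0.
exists (N + C).+1 => // n; apply: (complexity_unbounded HA Hfact Hunb (N := N)) => j Nj.
have := HN j Nj; rewrite /= mulrC ler_pdivlMr ?ltr0n ?addn3 // -natrM ler_nat => h.
have := complexity_gt0 HA Hfact Hunb j; nia.
Qed.

(** The ratio bound is a premise at each [n] separately, so the estimate can also be used when the
    bound holds only infinitely often. *)
Lemma not_line_small r (e : R) : 0 < e -> exists2 d : R, 0 < d &
  \forall n \near \oo, (p n.+1)%:R <= (1 + d) * (p n)%:R ->
    #|[pred x : W n | ~~ `[< line_nbhd (@rauzy_arcs A L n) r x >]]|%:R <= e * (p n)%:R.
Proof.
move=> e0; pose c := ball_const A r; pose c2 := period_const A r.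
have c0 : (0 : R) < c%:R by rewrite ltr0n expn_gt0.
(* Growth and the two kinds of dead words cost 2d each, the periodic words cost d: in all 7d per
   vertex, times the ball constant. *)
pose d := e / (c%:R * 7).
have d0 : 0 < d by rewrite divr_gt0 // mulr_gt0.
exists d => //.
have hr := right_dead_small d0; have hl := left_dead_small d0.
have [K HK] : exists K : nat, c2%:R / d <= K%:R.
  by exists (Num.truncn (c2%:R / d)).+1; apply: ltW; rewrite truncnS_gt.
have hp := complexity_near K.
apply: filterS3 hr hl hp => n hr hl hp hd.
have := card_not_line HA Hfact n r; rewrite -/c -/c2.
move/(congr1 (fun b : bool => b)) => /=.
rewrite -(ler_nat R) !(natrD, natrM, mulrDr) -!addnn !natrD => H.
have hc2 : c2%:R <= d * (p n)%:R.
  rewrite mulrC -ler_pdivrMr //; apply: le_trans HK _.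
  by rewrite ler_nat ltnW.
have eE : e = c%:R * (7 * d) by rewrite /d; field; rewrite lt0r_neq0.
have K1 : c%:R * (p n.+1)%:R <= c%:R * ((1 + d) * (p n)%:R) by rewrite ler_pM2l.
have K2 : c%:R * (right_dead L n)%:R <= c%:R * (d * (p n)%:R) by rewrite ler_pM2l.
have K3 : c%:R * (left_dead L n)%:R <= c%:R * (d * (p n)%:R) by rewrite ler_pM2l.
have K4 : c%:R * c2%:R <= c%:R * (d * (p n)%:R) by rewrite ler_pM2l.
rewrite eE; lra.
Qed.

Lemma subexponential_ratio : subexponential L R -> forall (d : R) N, 0 < d ->
  exists2 n, (N <= n)%N & (p n.+1)%:R <= (1 + d) * (p n)%:R.
Proof.
move=> sub d N d0; apply: contrapT => H.
have d1 : 1 < 1 + d by lra.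
have gr j : (1 + d) ^+ j <= (p (N + j))%:R.
  elim: j => [|j IH]; first by rewrite expr0 ler1n; exact: complexity_gt0.
  have : (1 + d) * (p (N + j))%:R < (p (N + j).+1)%:R.
    by rewrite ltNge; apply/negP => h; apply: H; exists (N + j)%N => //; exact: leq_addr.
  rewrite addnS exprS => /ltW; apply: le_trans.
  by rewrite ler_pM2l //; lra.
have l0 : 0 < ln (1 + d) by rewrite ln_gt0.
(* If the ratio always exceeded 1 + d, then ln p(N+j) / (N+j) would be at least ln (1+d) / 2 once j
   >= N, which is above this third. *)
have l20 : 0 < ln (1 + d) / 3 by rewrite divr_gt0.
have /cvgrPdist_le/(_ _ l20)[M _ HM] := sub.
pose j := (N + M).+1.
have := HM (N + j)%N; rewrite /= sub0r normrN.
move=> /(_ _)/wrap[]; first by rewrite /j /=; lia.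
have lnj : ln (1 + d) *+ j <= ln (p (N + j))%:R.
  rewrite -lnXn; last by lra.
  by rewrite ler_ln ?posrE ?exprn_gt0 ?gr //; lra.
move=> /(le_trans (ler_norm _)); rewrite ler_pdivrMr; last by rewrite ltr0n /j addnS.
move=> /(le_trans lnj); rewrite -mulr_natr => h.
have jN : (N + j)%:R <= 2 * j%:R :> R by rewrite -natrM ler_nat /j; lia.
have j0 : 0 < j%:R :> R by rewrite ltr0n.
have := ler_wpM2l (ltW l20) jN; have := mulr_gt0 l0 j0; lra.
Qed.

(** Only the upper bound has to be supplied: almost every word has a right extension, which bounds
    the ratio below. *)
Lemma ratio_cvg1 :
  (forall d : R, 0 < d -> \forall n \near \oo, (p n.+1)%:R <= (1 + d) * (p n)%:R) ->
  ((fun n => (p n.+1)%:R / (p n)%:R : R) @ \oo --> (1 : R))%classic.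
Proof.
move=> H; apply/cvgrPdist_le => e e0.
apply: filterS2 (H _ e0) (right_dead_small e0) => n h1 h2.
have := complexity_succ_ge Hfact n; rewrite -(ler_nat R) natrD => h3.
rewrite ler_norml; apply/andP; split.
  rewrite lerBrDr addrC lerBlDr ler_pdivrMr //; lra.
rewrite lerBlDl -lerBlDr ler_pdivlMr //; lra.
Qed.

Lemma ratio_le_near :
  ((fun n => (p n.+1)%:R / (p n)%:R : R) @ \oo --> (1 : R))%classic ->
  forall d : R, 0 < d -> \forall n \near \oo, (p n.+1)%:R <= (1 + d) * (p n)%:R.
Proof.
move=> H d d0; have /cvgrPdist_le/(_ _ d0) := H; apply: filterS => n.
by rewrite ler_norml -ler_pdivrMr // => /andP[h _]; lra.
Qed.

(** Since p(0) = 1, ln p(n) / n is the Cesaro mean of the numbers ln (p(k+1) / p(k)), which tend to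
    0. *)
Lemma ratio_subexponential :
  ((fun n => (p n.+1)%:R / (p n)%:R : R) @ \oo --> (1 : R))%classic ->
  subexponential L R.
Proof.
move=> H; pose u n : R := ln (p n)%:R.
have u0 : u 0%N = 0.
  rewrite /u; have -> : p 0 = 1%N; last by rewrite ln1.
  apply/eqP; rewrite eqn_leq complexity_gt0 // andbT.
  exact: complexity_le.
have : (telescope u @ \oo --> (0 : R))%classic.
  rewrite -(@ln1 R); have E : telescope u = (fun n => ln ((p n.+1)%:R / (p n)%:R)).
    by apply/funext => n; rewrite /telescope /u /= lnM ?posrE ?invr_gt0 // lnV ?posrE.
  by rewrite E; exact: (cvg_comp _ _ H (continuous_ln (@ltr01 R))).
move=> /cesaro; rewrite /arithmetic_mean telescopeK => h.
rewrite /subexponential -cvg_shiftS; apply: cvg_trans h; apply: near_eq_cvg.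
by near=> n; rewrite /= u0 subr0 mulrC.
Unshelve. all: by end_near.
Qed.

(** * Frequencies of ball types *)

Section Freq.
Variables (U : finType) (mU : U -> U -> nat) (r : nat) (w : U).

Lemma ball_freqE (V : finType) (m : V -> V -> nat) :
  ball_freq R m mU r w = #|[pred v | `[< ball_iso m mU r v w >]]|%:R / #|V|%:R.
Proof. by rewrite /ball_freq card_cset. Qed.

Lemma ball_freq_le1 (V : finType) (m : V -> V -> nat) : ball_freq R m mU r w <= 1.
Proof.
rewrite ball_freqE; have [->|V0] := eqVneq #|V| 0%N; first by rewrite invr0 mulr0.
by rewrite ler_pdivrMr ?ltr0n ?lt0n // mul1r ler_nat max_card.
Qed.

Lemma ball_freq_ge0 (V : finType) (m : V -> V -> nat) : 0 <= ball_freq R m mU r w.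
Proof. by rewrite ball_freqE divr_ge0. Qed.

Lemma ball_freq_cvg1 (V : nat -> finType) (m : forall n, V n -> V n -> nat) :
  (forall e : R, 0 < e -> \forall n \near \oo, 1 - e <= ball_freq R (m n) mU r w) ->
  ((fun n => ball_freq R (m n) mU r w) @ \oo --> (1 : R))%classic.
Proof.
move=> H; apply/cvgrPdist_le => e /H; apply: filterS => n h.
have := ball_freq_le1 (m n); rewrite ler_norml => h'; apply/andP; split; lra.
Qed.

End Freq.

(** When one ball type has asymptotic frequency 1, every test ball has limit 1 or 0, according to
    whether it is of that type. *)
Lemma BS_limit_of_rooted (V : nat -> finType) (m : forall n, V n -> V n -> nat)
    (U : nat -> finType) (mU : forall r, U r -> U r -> nat) (w : forall r, U r) :
  (forall n, 0 < #|V n|)%N ->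
  (forall r, ((fun n => ball_freq R (m n) (@mU r) r (w r)) @ \oo --> (1 : R))%classic) ->
  BS_limit_exists R m.
Proof.
move=> V0 H r k mH o; have [h|h] := pselect (ball_iso (@mU r) mH r (w r) o).
  exists 1; apply: ball_freq_cvg1 => e e0.
  have /cvgrPdist_le/(_ _ e0) := H r; apply: filterS => n.
  rewrite ler_norml => /andP[_ h1]; rewrite lerBlDl -lerBlDr; apply: le_trans h1.
  rewrite lerB // !ball_freqE ler_pM2r ?invr_gt0 ?ltr0n // ler_nat.
  apply: subset_leq_card; apply/fintype.subsetP => v; rewrite !inE  => hv.
  exact: ball_iso_trans hv h.
exists 0; apply/cvgrPdist_le => e e0.
have /cvgrPdist_le/(_ _ e0) := H r; apply: filterS => n.
rewrite ler_norml sub0r normrN ger0_norm ?ball_freq_ge0 // => /andP[_ h1].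
apply: le_trans h1; rewrite lerBrDr !ball_freqE -mulrDl.
rewrite ler_pdivrMr ?ltr0n // mul1r -natrD ler_nat -[X in (_ <= X)%N](cardC [pred v | `[< ball_iso (m n) mH r v o >]]).
rewrite leq_add2l; apply: subset_leq_card; apply/fintype.subsetP => v; rewrite !inE => hv.
by apply/negP => /asboolP hv'; apply: h; exact: ball_iso_trans (ball_iso_sym hv) hv'.
Qed.

Lemma dZ_freq r (e : R) : 0 < e -> exists2 d : R, 0 < d &
  \forall n \near \oo, (p n.+1)%:R <= (1 + d) * (p n)%:R ->
    1 - e <= ball_freq R (@rauzy_arcs A L n) (@dZline r) r (Zroot r).
Proof.
move=> e0; have [d d0 H] := not_line_small r e0; exists d => //.
apply: filterS H => n H /H {}H; rewrite ball_freqE ler_pdivlMr //.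
rewrite mulrBl mul1r lerBlDl; apply: le_trans (lerD H (lexx _)).
rewrite -natrD ler_nat -(cardC [pred x : W n | ~~ `[< line_nbhd (@rauzy_arcs A L n) r x >]]).
rewrite leq_add2l; apply: subset_leq_card; apply/fintype.subsetP => v; rewrite !inE ?negbK ?asboolE => hv.
  exact: line_nbhd_iso hv (dZline_nbhd r).
exact: p0.
Qed.

Lemma dZ_freq_le_Z_freq n r :
  ball_freq R (@rauzy_arcs A L n) (@dZline r) r (Zroot r) <=
  ball_freq R (@rauzy_edges A L n) (@Zline r) r (Zroot r).
Proof.
have q0 : 0 < #|W n|%:R :> R by exact: p0.
rewrite !ball_freqE ler_pM2r ?invr_gt0 // ler_nat; apply: subset_leq_card.
apply/fintype.subsetP => v; rewrite !inE => hv.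
by rewrite Zline_symm; exact: ball_iso_symm hv.
Qed.

Lemma Z_freq r (e : R) : 0 < e -> exists2 d : R, 0 < d &
  \forall n \near \oo, (p n.+1)%:R <= (1 + d) * (p n)%:R ->
    1 - e <= ball_freq R (@rauzy_edges A L n) (@Zline r) r (Zroot r).
Proof.
move=> /(dZ_freq r)[d d0 H]; exists d => //; apply: filterS H => n H /H.
by move/le_trans; apply; exact: dZ_freq_le_Z_freq.
Qed.

Lemma subexponential_freq_limit (u : nat -> R) (l : R) : subexponential L R ->
  (u @ \oo --> l)%classic -> (forall n, u n <= 1) ->
  (forall e : R, 0 < e -> exists2 d : R, 0 < d &
    \forall n \near \oo, (p n.+1)%:R <= (1 + d) * (p n)%:R -> 1 - e <= u n) -> l = 1.
Proof.
move=> sub ul u1 H; apply: (cvg_frequently ul) => e N e0.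
have [d d0 [M _ HM]] := H _ e0.
have [n nNM hn] := subexponential_ratio sub (maxn N M) d0.
move: nNM; rewrite geq_max => /andP[Nn Mn]; exists n => //.
have := HM n Mn hn; have := u1 n; rewrite ler_norml => ? ?; apply/andP; split; lra.
Qed.

Lemma subexp_BS_dZ : subexponential L R -> BS_limit_exists R (@rauzy_arcs A L) ->
  BS_conv_to_dZ R (@rauzy_arcs A L).
Proof.
move=> sub BS r; have [l hl] := BS r _ (@dZline r) (Zroot r).
suff <- : l = 1 by [].
apply: (subexponential_freq_limit sub hl); first by move=> n; exact: ball_freq_le1.
by move=> e; exact: dZ_freq.
Qed.

Lemma subexp_BS_Z : subexponential L R -> BS_limit_exists R (@rauzy_edges A L) ->
  BS_conv_to_Z R (@rauzy_edges A L).
Proof.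
move=> sub BS r; have [l hl] := BS r _ (@Zline r) (Zroot r).
suff <- : l = 1 by [].
apply: (subexponential_freq_limit sub hl); first by move=> n; exact: ball_freq_le1.
by move=> e; exact: Z_freq.
Qed.

Lemma dZ_Z : BS_conv_to_dZ R (@rauzy_arcs A L) -> BS_conv_to_Z R (@rauzy_edges A L).
Proof.
move=> H r; apply: ball_freq_cvg1 => e e0.
have /cvgrPdist_le/(_ _ e0) := H r; apply: filterS => n.
rewrite ler_norml => /andP[_ h1]; have := dZ_freq_le_Z_freq n r; lra.
Qed.

Lemma edges_le n (x : W n) : (\sum_y rauzy_edges x y <= #|A|.*2)%N.
Proof.
apply: (@leq_trans (\sum_y (rauzy_arcs x y + rauzy_arcs y x))%N).
  by apply: leq_sum => y _; rewrite /rauzy_edges; case: eqVneq => [->|_] //; exact: leq_addr.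
rewrite big_split -addnn /=; apply: leq_add; first exact: outdeg_le.
exact: indeg_le.
Qed.

Lemma sum_gball1 (V : finType) (m : V -> V -> nat) v :
  (\sum_y m v y = \sum_(y in gball m 1 v) m v y)%N.
Proof.
rewrite [RHS]big_mkcond; apply: eq_bigr => y _; case: ifP => // /negP yb.
apply/eqP; rewrite -leqn0 leqNgt; apply/negP => h; apply: yb.
by apply: (gball_adj (gball_center m 0 v)); rewrite /gadj addn_gt0 h.
Qed.

(** All neighbours of [v] lie in its 1-ball, so the isomorphism determines the degree,
    multiplicities included. *)
Lemma line_degree (V : finType) (m : V -> V -> nat) v :
  ball_iso m (@Zline 1) 1 v (Zroot 1) -> (\sum_y m v y = 2)%N.
Proof.
case=> f [fv fI fB fm].
have -> : (\sum_y m v y = \sum_y Zline (Zroot 1) y)%N.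
  rewrite !sum_gball1 -fB big_imset //=; apply: eq_bigr => y yb.
  by rewrite fm ?fv // gball_center.
by rewrite !big_ord_recl big_ord0 /Zline /= !inordK.
Qed.

Lemma Z_ratio : BS_conv_to_Z R (@rauzy_edges A L) ->
  ((fun n => (p n.+1)%:R / (p n)%:R : R) @ \oo --> (1 : R)).
Proof.
move=> /(_ 1%N) Z1; apply: ratio_cvg1 => d d0.
pose a : R := #|A|%:R.
have a0 : 0 < a by rewrite ltr0n ltnW.
(* Exceptional vertices have degree at most 2a, so this proportion costs d p(n). The loop correction
   [a] costs d p(n) more, which is what the bound on 2 p(n+1) allows. *)
have e0 : 0 < d / (a * 2) by rewrite divr_gt0 // mulr_gt0.
have [K HK] : exists K : nat, a / d <= K%:R.
  by exists (Num.truncn (a / d)).+1; apply: ltW; rewrite truncnS_gt.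
have /cvgrPdist_le/(_ _ e0) := Z1.
apply: filterS3 (complexity_near K) (nbhs_infty_gt 0) => n pK n0 hn.
pose good := [pred v : W n | `[< ball_iso (@rauzy_edges A L n) (@Zline 1) 1 v (Zroot 1) >]].
have H1 : (\sum_(x : W n) \sum_y rauzy_edges x y <= (p n).*2 + #|A|.*2 * #|predC good|)%N.
  rewrite -muln2 mulnC /complexity -[X in (2 * X)%N]sum1_card -[#|predC good|]sum1_card [X in (_ + _ * X)%N]big_mkcond.
  rewrite !big_distrr -big_split /=; apply: leq_sum => x _; rewrite !inE.
  case: asboolP => [/line_degree ->|_]; first by lia.
  by have := edges_le x; rewrite /=; lia.
have H2 : (#|good|%:R + #|predC good|%:R = (p n)%:R :> R) by rewrite -natrD cardC.
have H3 : (#|predC good|%:R : R) <= d / (a * 2) * (p n)%:R.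
  rewrite -ler_pdivrMr //; move: hn; rewrite ler_norml => /andP[_].
  rewrite ball_freqE -/good -/(p n) -[X in X - _](divff (lt0r_neq0 (p0 n))) -mulrBl.
  by rewrite -H2 addrAC subrr add0r.
have := leq_trans (sum_edges HA Hfact n0) (leq_add H1 (leqnn _)).
rewrite -(ler_nat R) !(natrD, natrM) -!muln2 !natrM -/a => H4.
have H5 : a <= d * (p n)%:R.
  rewrite mulrC -ler_pdivrMr //; apply: le_trans HK _; by rewrite ler_nat ltnW.
have H6 : a * #|predC good|%:R <= a * (d / (a * 2) * (p n)%:R) by rewrite ler_pM2l.
have E : a * (d / (a * 2) * (p n)%:R) = d * (p n)%:R / 2 by field; rewrite lt0r_neq0.
lra.
Qed.

End LanguageLimits.

(** * Weierstrass approximation *)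

Section Weierstrass.
Variable R : realType.
Implicit Types (h : nat -> R) (u : R).

(* Expectation of h at a binomial variable, as a polynomial in the success probability:
   [(bernstein n h).[u]] is the sum over i <= n of h i 'C(n, i) u^i (1 - u)^(n - i). *)
Fixpoint bernstein (n : nat) h : {poly R} :=
  if n is n'.+1 then 'X * bernstein n' (fun i => h i.+1) + (1 - 'X) * bernstein n' h
  else (h 0%N)%:P.

Lemma bernsteinS n h u : (bernstein n.+1 h).[u] =
  u * (bernstein n (fun i => h i.+1)).[u] + (1 - u) * (bernstein n h).[u].
Proof. by rewrite /= !hornerE. Qed.

Lemma ler_bernstein n h h' u : 0 <= u <= 1 -> (forall i, (i <= n)%N -> h i <= h' i) ->
  (bernstein n h).[u] <= (bernstein n h').[u].
Proof.
move=> /andP[u0 u1]; elim: n h h' => [|n IH] h h' hh'; first by rewrite /= !hornerE hh'.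
rewrite !bernsteinS lerD // ler_wpM2l ?subr_ge0 //; apply: IH => i ni; apply: hh' => //.
exact: leqW.
Qed.

Lemma bernstein_affine n (a b : R) h u :
  (bernstein n (fun i => a + b * h i)).[u] = a + b * (bernstein n h).[u].
Proof.
elim: n h => [|n IH] h; first by rewrite /= !hornerE.
by rewrite !bernsteinS (IH (fun i => h i.+1)) IH; ring.
Qed.

(** The centre [c] is arbitrary because the induction shifts it by one; at c = n u this is the
    binomial variance. *)
Lemma bernstein_variance n (c : R) u :
  (bernstein n (fun i => (i%:R - c) ^+ 2)).[u] = n%:R * (u * (1 - u)) + (n%:R * u - c) ^+ 2.
Proof.
elim: n c => [|n IH] c; first by rewrite /= !hornerE; ring.
rewrite bernsteinS IH.
have -> : (fun i => (i.+1%:R - c) ^+ 2) = (fun i => (i%:R - (c - 1)) ^+ 2).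
  by apply/funext => i; rewrite -natr1; congr (_ ^+ 2); ring.
by rewrite IH -natr1; ring.
Qed.

Lemma unif_continuous_segment (f : R -> R) (a b e : R) : continuous f -> 0 < e ->
  exists2 d, 0 < d & forall x y, a <= x <= b -> `|x - y| < d -> `|f x - f y| <= e.
Proof.
move=> cf e0.
pose P (d x : R) := forall y, `|x - y| < d -> `|f x - f y| <= e.
(* The modulus is the parameter of the covering: near each point all small moduli work, hence all
   small moduli work on the whole segment. *)
have /compact_near_coveringP/(_ R (0 : R)^'+ P _) := @segment_compact R a b.
case.
  move=> x _.
  have e20 : 0 < e / 2 by rewrite divr_gt0.
  have /cvgrPdist_le/(_ _ e20)[d /= d0 Hd] := cf x.
  exists (ball x (d / 2), [set t : R | t < d / 2]) => /=.
    split => /=; first by exists (d / 2) => //=; rewrite divr_gt0.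
    by apply: nbhs_right_lt; rewrite divr_gt0.
  move=> [x' t] [/= xx' td] y x'y.
  have h1 := Hd x'; have h2 := Hd y; rewrite /ball /= in h1 h2 xx'.
  have h3 : `|f x - f x'| <= e / 2 by apply: h1; lra.
  have h4 : `|f x - f y| <= e / 2.
    apply: h2; have -> : x - y = (x - x') + (x' - y) by ring.
    apply: le_lt_trans (ler_normD _ _) _; lra.
  have -> : f x' - f y = (f x - f y) - (f x - f x') by ring.
  apply: le_trans (ler_normB _ _) _; lra.
move=> d /= d0 Hd; exists (d / 2); first by rewrite divr_gt0.
move=> x y xab xy; have := Hd (d / 2); apply => //=.
- rewrite sub0r normrN gtr0_norm ?divr_gt0 //; lra.
- by rewrite divr_gt0.
Qed.

Lemma weierstrass (f : R -> R) (K e : R) : bounded_continuous f -> 0 < K -> 0 < e ->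
  exists q : {poly R}, forall x, - K <= x <= K -> `|f x - q.[x]| <= e.
Proof.
case=> cf [M HM] K0 e0.
pose g u := f (2 * K * u - K).
have M0 : 0 <= M by apply: le_trans (HM 0).
have [d d0 Hd] : exists2 d, 0 < d &
    forall x y, 0 <= x <= 1 -> `|x - y| < d -> `|g x - g y| <= e / 2.
  have e20 : 0 < e / 2 by rewrite divr_gt0.
  have [d d0 Hd] := @unif_continuous_segment f (- K) K (e / 2) cf e20.
  exists (d / (2 * K)); first by rewrite divr_gt0 // mulr_gt0.
  move=> x y /andP[x0 x1] xy; apply: Hd; first by apply/andP; split; nra.
  have -> : 2 * K * x - K - (2 * K * y - K) = 2 * K * (x - y) by ring.
  by rewrite normrM gtr0_norm ?mulr_gt0 // mulrC -ltr_pdivlMr ?mulr_gt0.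
(* The variance term will be at most 2M / (d^2 n), which this choice makes at most e / 2. *)
have [n [n0 nE]] : exists n : nat, 0 < n%:R :> R /\ 4 * M / (d ^+ 2 * e) < n%:R.
  by exists (Num.truncn (4 * M / (d ^+ 2 * e))).+1; rewrite ltr0n truncnS_gt.
pose h i := g (i%:R / n%:R).
exists (bernstein n h \Po ((2 * K)^-1 *: ('X + K%:P))) => x /andP[xK xK'].
rewrite horner_comp; set u := horner _ x.
have uE : u = (2 * K)^-1 * (x + K) by rewrite /u !hornerE.
have fE : f x = g u by rewrite /g uE; congr f; field; rewrite lt0r_neq0.
have u01 : 0 <= u <= 1.
  by rewrite uE mulrC ler_pdivrMr ?mulr_gt0 // divr_ge0 /=; lra.
(* When i / n is at distance at least [d] from [u], the quadratic term with this factor is at least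
   2M, the trivial bound. *)
pose c := 2 * M / (d ^+ 2 * n%:R ^+ 2).
have c0 : 0 <= c by rewrite divr_ge0 ?mulr_ge0 ?exprn_ge0 // ltW.
have bnd i : (i <= n)%N -> `|g u - h i| <= e / 2 + c * (i%:R - n%:R * u) ^+ 2.
  move=> _; have [ud|ud] := ltP `|u - i%:R / n%:R| d.
    by apply: le_trans (Hd _ _ u01 ud) _; rewrite lerDl mulr_ge0 // sqr_ge0.
  have h1 : `|g u - h i| <= 2 * M.
    apply: le_trans (ler_normB _ _) _; have := HM (2 * K * u - K).
    have := HM (2 * K * (i%:R / n%:R) - K); rewrite -/(g _) -/(h _) -/(g u); lra.
  apply: le_trans h1 _.
  have -> : c * (i%:R - n%:R * u) ^+ 2 = 2 * M * ((u - i%:R / n%:R) ^+ 2 / d ^+ 2).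
    by rewrite /c; field; rewrite !lt0r_neq0.
  have : 1 <= (u - i%:R / n%:R) ^+ 2 / d ^+ 2.
    rewrite ler_pdivlMr ?exprn_gt0 // mul1r -[leRHS]real_normK ?num_real //.
    by rewrite ler_sqr ?nnegrE ?normr_ge0 // ltW.
  move=> h2; have := ler_wpM2l M0 h2; lra.
have e1 : e / 2 + c * (bernstein n (fun i => (i%:R - n%:R * u) ^+ 2)).[u] <= e.
  rewrite bernstein_variance subrr expr0n addr0.
  have -> : c * (n%:R * (u * (1 - u))) = 2 * M / (d ^+ 2 * n%:R) * (u * (1 - u)).
    by rewrite /c; field; rewrite !lt0r_neq0.
  have h1 : u * (1 - u) <= 1 by nra.
  have h2 : 2 * M / (d ^+ 2 * n%:R) <= e / 2.
    rewrite ler_pdivrMr ?mulr_gt0 ?exprn_gt0 //.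
    move: (ltW nE); rewrite ler_pdivrMr ?mulr_gt0 ?exprn_gt0 //; lra.
  have h3 : 0 <= 2 * M / (d ^+ 2 * n%:R).
    by rewrite divr_ge0 ?mulr_ge0 ?exprn_ge0 // ltW.
  nra.
(* Monotonicity and affinity of [bernstein] turn bounds on the values [h i] into bounds on the
   polynomial at [u]. *)
rewrite fE ler_norml; apply/andP; split.
- have := @ler_bernstein n h (fun i => (g u + e / 2) + c * (i%:R - n%:R * u) ^+ 2) u u01.
  rewrite bernstein_affine => H; suff : forall i, (i <= n)%N ->
    h i <= g u + e / 2 + c * (i%:R - n%:R * u) ^+ 2 by move=> /H; lra.
  by move=> i /bnd; rewrite ler_norml => /andP[? ?]; lra.
- have := @ler_bernstein n (fun i => (g u - e / 2) + (- c) * (i%:R - n%:R * u) ^+ 2) h u u01.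
  rewrite bernstein_affine => H; suff : forall i, (i <= n)%N ->
    g u - e / 2 + - c * (i%:R - n%:R * u) ^+ 2 <= h i by move=> /H; lra.
  by move=> i /bnd; rewrite ler_norml => /andP[? ?]; lra.
Qed.

End Weierstrass.

(** * The arcsine law *)

Section Arcsine.
Variable R : realType.
Notation mu := (@lebesgue_measure R).
Implicit Types f g : R -> R.

(** The arcsine integral after x = 2 cos t: the integrand is continuous on a compact segment, free
    of the singularities at -2 and 2. *)
Definition arcsine_mean f : R := pi^-1 * (\int[mu]_(t in `[0, pi]) f (2 * cos t))%R.

Lemma continuous_2cos : continuous (fun t : R => 2 * cos t).
Proof. by move=> t; apply: cvgM; [exact: cvg_cst|exact: continuous_cos]. Qed.

Lemma continuous_comp_2cos f : continuous f -> continuous (fun t => f (2 * cos t)).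
Proof.
move=> cf t; apply: (@continuous_comp _ _ _ (fun t : R => 2 * cos t) f) => //.
  exact: continuous_2cos.
exact: cf.
Qed.

Lemma integrable_comp_2cos f : continuous f ->
  mu.-integrable `[0, pi] (EFin \o (fun t => f (2 * cos t))).
Proof.
move=> cf; apply: continuous_compact_integrable; first exact: segment_compact.
by apply: continuous_subspaceT; exact: continuous_comp_2cos.
Qed.

Lemma arcsine_meanD f g : continuous f -> continuous g ->
  arcsine_mean (f \+ g) = arcsine_mean f + arcsine_mean g.
Proof.
move=> cf cg; rewrite /arcsine_mean -mulrDr -RintegralD //; exact: integrable_comp_2cos.
Qed.

Lemma arcsine_meanZ (a : R) f : continuous f ->
  arcsine_mean (fun x => a * f x) = a * arcsine_mean f.
Proof.
by move=> cf; rewrite /arcsine_mean RintegralZl 1?mulrCA //; exact: integrable_comp_2cos.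
Qed.

Lemma arcsine_mean_cst (a : R) : arcsine_mean (fun=> a) = a.
Proof.
rewrite /arcsine_mean Rintegral_cst //= lebesgue_measure_itv /= lte_fin pi_gt0 /=.
by rewrite subr0 mulrCA mulVf ?mulr1 // lt0r_neq0 // pi_gt0.
Qed.

Lemma range_2cos (t : R) : -2 <= 2 * cos t <= 2.
Proof. by have := cos_geN1 t; have := cos_le1 t => ? ?; apply/andP; split; lra. Qed.

Lemma arcsine_mean_le f g (e : R) : continuous f -> continuous g ->
  (forall x, -2 <= x <= 2 -> f x <= g x + e) -> arcsine_mean f <= arcsine_mean g + e.
Proof.
move=> cf cg fg; rewrite -[X in _ + X](arcsine_mean_cst e).
have ce : continuous (fun _ : R => e) by move=> x; exact: cvg_cst.
rewrite -arcsine_meanD // /arcsine_mean ler_pM2l ?invr_gt0 ?pi_gt0 //.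
apply: le_Rintegral => //.
- exact: integrable_comp_2cos.
- by apply: (@integrable_comp_2cos (fun x => g x + e)) => x; apply: cvgD; [exact: cg|exact: ce].
- by move=> t _; apply: fg; exact: range_2cos.
Qed.

Lemma arcsine_mean_dist f g (e : R) : continuous f -> continuous g ->
  (forall x, -2 <= x <= 2 -> `|f x - g x| <= e) -> `|arcsine_mean f - arcsine_mean g| <= e.
Proof.
move=> cf cg fg; rewrite ler_norml; apply/andP; split.
  rewrite lerBrDr addrC lerBlDr; apply: arcsine_mean_le => // x /fg.
  by rewrite ler_norml => /andP[? ?]; lra.
rewrite lerBlDl; apply: arcsine_mean_le => // x /fg.
by rewrite ler_norml => /andP[? ?]; lra.
Qed.

Lemma sin_natmul_pi n : sin (n%:R * pi) = 0 :> R.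
Proof.
elim: n => [|n IH]; first by rewrite mul0r sin0.
by rewrite -natr1 mulrDl mul1r sinDpi IH oppr0.
Qed.

Lemma Rintegral_cos_mul n : (0 < n)%N -> (\int[mu]_(t in `[0%R, pi]) (2 * cos (n%:R * t)))%R = 0 :> R.
Proof.
move=> n0; have n0' : n%:R != 0 :> R by rewrite pnatr_eq0 -lt0n.
pose F (t : R) := 2 / n%:R * sin (n%:R * t).
have dF (t : R) : is_derive t 1 F (2 * cos (n%:R * t)).
  have d1 : is_derive t 1 (fun t : R => n%:R * t) n%:R.
    apply: (is_derive_eq (@is_deriveZ R R R id n%:R t 1 1 (is_derive_id _ _))).
    by rewrite /GRing.scale /= mulr1.
  have d2 : is_derive t 1 (fun t : R => sin (n%:R * t)) (n%:R * cos (n%:R * t)).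
    apply: (is_derive_eq (@is_derive1_comp R sin (fun t : R => n%:R * t) t _ _ _ d1)).
    by rewrite mulrC.
  apply: (is_derive_eq (@is_deriveZ R R R _ (2 / n%:R) t 1 _ d2)).
  by rewrite /GRing.scale /=; field.
have cF : continuous F by move=> t; apply: differentiable_continuous; apply/derivable1_diffP; exact: ex_derive.
rewrite /Rintegral (@continuous_FTC2 R (fun t => 2 * cos (n%:R * t)) F) ?pi_gt0 //.
- by rewrite -EFinB /= /F mulr0 sin0 sin_natmul_pi !mulr0 subrr.
- apply: continuous_subspaceT => t; apply: cvgM; first exact: cvg_cst.
  apply: continuous_comp; last exact: continuous_cos.
  by apply: cvgM; [exact: cvg_cst|exact: cvg_id].
- split.
  + by move=> t _; exact: ex_derive.
  + by apply: cvg_at_right_filter; exact: cF.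
  + by apply: cvg_at_left_filter; exact: cF.
- by move=> t _; rewrite derive1E derive_val.
Qed.

(** This is 2 T_j(x/2), with T_j the Chebyshev polynomial of the first kind; hence the constant 2 at
    index 0. *)
Fixpoint chebyshev (j : nat) : {poly R} :=
  match j with
  | 0 => 2%:P
  | 1 => 'X
  | (j'.+1 as i).+1 => 'X * chebyshev i - chebyshev j'
  end.

Lemma chebyshevSS j : chebyshev j.+2 = 'X * chebyshev j.+1 - chebyshev j.
Proof. by []. Qed.

Lemma chebyshev_cos j (t : R) : (chebyshev j).[2 * cos t] = 2 * cos (j%:R * t).
Proof.
have [n] := ubnP j; elim: n j => // n IH [_|[_|j jn]].
- by rewrite /= hornerC mul0r cos0 mulr1.
- by rewrite /= hornerX mul1r.
rewrite chebyshevSS hornerD hornerN hornerM hornerX !IH; try lia.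
have -> : j.+2%:R * t = (j.+1%:R * t) + t by rewrite -[in LHS]natr1; ring.
have -> : j%:R * t = (j.+1%:R * t) - t by rewrite -natr1; ring.
rewrite cosB cosD; ring.
Qed.

Lemma arcsine_mean_chebyshev j : (0 < j)%N -> arcsine_mean (horner (chebyshev j)) = 0.
Proof.
move=> j0; rewrite /arcsine_mean; under eq_Rintegral do rewrite chebyshev_cos.
by rewrite Rintegral_cos_mul // mulr0.
Qed.

End Arcsine.

Section ArcsineLaw.
Variable R : realType.
Notation mu := (@lebesgue_measure R).
Implicit Types f g : R -> R.

Definition arcsine_density (x : R) : R := (pi * Num.sqrt (4 - x ^+ 2))^-1.

Lemma arcsine_density_ge0 x : 0 <= arcsine_density x.
Proof. by rewrite invr_ge0 mulr_ge0 ?pi_ge0 ?sqrtr_ge0. Qed.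

Lemma sqr_lt4 (x : R) : -2 < x < 2 -> 0 < 4 - x ^+ 2.
Proof. by move=> /andP[? ?]; nra. Qed.

Lemma continuous_arcsine_density f (x : R) : continuous f -> -2 < x < 2 ->
  {for x, continuous (fun x => f x * arcsine_density x)}.
Proof.
move=> cf x2; apply: cvgM; first exact: cf.
apply: cvgV; first by rewrite mulf_neq0 ?lt0r_neq0 ?pi_gt0 // sqrtr_gt0 sqr_lt4.
apply: cvgM; first exact: cvg_cst.
apply: (@continuous_comp _ _ _ (fun x : R => 4 - x ^+ 2) Num.sqrt); last exact: sqrt_continuous.
apply: cvgB; first exact: cvg_cst.
exact: exprn_continuous.
Qed.

(** The substitution x = 2 cos t is made on intervals truncated by [eps n], away from -2 and 2 where
    the density is unbounded. *)
Let eps n : R := n.+1%:R^-1.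

Let eps0 n : 0 < eps n. Proof. by rewrite invr_gt0. Qed.

Let eps1 n : eps n <= pi - eps n.
Proof.
have : eps n <= 1 by rewrite invf_le1 ?ltr0n // ler1n.
by have := pi_ge2 R; lra.
Qed.

Let eps_nonincr m n : (m <= n)%N -> eps n <= eps m.
Proof. by move=> mn; rewrite lef_pV2 ?posrE ?ltr0n // ler_nat. Qed.

Let angle n : set R := `[eps n, pi - eps n]%classic.
Let segm n : set R := `[2 * cos (pi - eps n), 2 * cos (eps n)]%classic.

Let in0pi n x : angle n x -> 0 < x < pi.
Proof.
rewrite /angle /= in_itv /= => /andP[h1 h2].
by apply/andP; split; have := eps0 n; lra.
Qed.

Let cos_lt (x y : R) : 0 <= x <= pi -> 0 <= y <= pi -> (cos x < cos y) = (y < x).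
Proof. by move=> xI yI; rewrite ltr_cos // in_itv. Qed.

Let cos_le (x y : R) : 0 <= x <= pi -> 0 <= y <= pi -> (cos x <= cos y) = (y <= x).
Proof. by move=> xI yI; rewrite !leNgt cos_lt. Qed.

Let epsI n : 0 <= eps n <= pi.
Proof. by apply/andP; split; have := eps0 n; have := eps1 n; lra. Qed.

Let epsI' n : 0 <= pi - eps n <= pi.
Proof. by apply/andP; split; have := eps0 n; have := eps1 n; lra. Qed.

Let bigcup_angle : \bigcup_n angle n = `]0, pi[%classic.
Proof.
apply/seteqP; split => x /=.
  by move=> [n _ /in0pi]; rewrite in_itv.
rewrite in_itv /= => /andP[x0 xpi].
(* The sum of both inverses brings 1/(n+1) below [x] and [pi - x] at once. *)
pose n := Num.truncn (x^-1 + (pi - x)^-1).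
have p1 : 0 < x^-1 by rewrite invr_gt0.
have p2 : 0 < (pi - x)^-1 by rewrite invr_gt0 subr_gt0.
have : x^-1 + (pi - x)^-1 < n.+1%:R by rewrite truncnS_gt.
move=> h; exists n => //; rewrite /angle /= in_itv /=.
have h1 : eps n <= x by rewrite -[leRHS]invrK lef_pV2 ?posrE // ltW //; lra.
have h2 : eps n <= pi - x by rewrite -[leRHS]invrK lef_pV2 ?posrE // ltW //; lra.
by apply/andP; split; lra.
Qed.

Let bigcup_segm : \bigcup_n segm n = `](-2), 2[%classic.
Proof.
apply/seteqP; split => x /=.
  move=> [n _]; rewrite /segm /= !in_itv /= => /andP[h1 h2].
  have := epsI n; have := epsI' n => e' e.
  have a1 : cos (eps n) < cos 0 by rewrite cos_lt ?lexx ?pi_ge0.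
  have a2 : cos pi < cos (pi - eps n) by rewrite cos_lt ?lexx ?pi_ge0 //; have := eps0 n; lra.
  by rewrite cos0 in a1; rewrite cospi in a2; apply/andP; split; lra.
rewrite in_itv /= => /andP[x2 x2'].
pose t := acos (x / 2).
have xI : -1 <= x / 2 <= 1 by apply/andP; split; lra.
have tx : 2 * cos t = x by rewrite /t acosK ?in_itv //; lra.
have t0 : 0 < t by apply: acos_gt0; apply/andP; split; lra.
have tpi : t < pi by apply: acos_ltpi; apply/andP; split; lra.
have : (\bigcup_n angle n) t by rewrite bigcup_angle /= in_itv /= t0.
case=> n _; rewrite /angle /= in_itv /= => /andP[h1 h2]; exists n => //.
have tI : 0 <= t <= pi by rewrite !ltW.
by rewrite /segm /= in_itv /= -tx !ler_pM2l // !cos_le ?h1 ?h2 // epsI epsI'.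
Qed.

Let nd_angle : nondecreasing_seq angle.
Proof.
move=> m n mn; rewrite subsetEset => x; rewrite /angle /= !in_itv /= => /andP[h1 h2].
by have := eps_nonincr mn => h; apply/andP; split; lra.
Qed.

Let nd_segm : nondecreasing_seq segm.
Proof.
move=> m n mn; rewrite subsetEset => x; rewrite /segm /= !in_itv /= => /andP[h1 h2].
have h := eps_nonincr mn.
have a1 : cos (eps m) <= cos (eps n) by rewrite cos_le.
have a2 : cos (pi - eps n) <= cos (pi - eps m) by rewrite cos_le //; lra.
by apply/andP; split; lra.
Qed.

Let segm_sub n x : segm n x -> -2 < x < 2.
Proof.
move=> h; have : (\bigcup_n segm n) x by exists n.
by rewrite bigcup_segm /= in_itv.
Qed.

Local Open Scope ereal_scope.

Let substitution f n : continuous f ->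
  \int[mu]_(x in segm n) (f x * arcsine_density x)%:E =
  \int[mu]_(t in angle n) (pi^-1 * f (2 * cos t))%:E.
Proof.
move=> cf; pose F (t : R) : R := (2 * cos t)%R.
have dF (t : R) : is_derive t 1%R F (- 2 * sin t)%R.
  apply: (is_derive_eq (@is_deriveZ R R R cos 2%R t 1%R _ (is_derive_cos t))).
  by rewrite /GRing.scale /= mulrN mulNr.
have F' : derive1 F = (fun t => - 2 * sin t)%R by apply/funext => t; rewrite derive1E derive_val.
have cF' : continuous (derive1 F).
  by rewrite F' => t; apply: cvgM; [exact: cvg_cst|exact: continuous_sin].
rewrite /segm (@integration_by_substitution_decreasing R F
  (fun x => f x * arcsine_density x)%R (eps n) (pi - eps n)) //.
- apply: eq_integral => t; rewrite inE => /in0pi tI; congr (_%:E).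
  have st : (0 < sin t)%R by exact: sin_gt0_pi.
  rewrite F'; change ((f (2 * cos t) * (pi * Num.sqrt (4 - (2 * cos t) ^+ 2))^-1) *
    - (- 2 * sin t) = pi^-1 * f (2 * cos t))%R.
  (* The root becomes 2 sin t, which cancels the derivative of the substitution. *)
  have -> : (4 - (2 * cos t) ^+ 2 = (2 * sin t) ^+ 2)%R.
    by rewrite !exprMn sin2cos2; ring.
  rewrite sqrtr_sqr ger0_norm ?mulr_ge0 ?(ltW st) //.
  have pi0 : (pi != 0 :> R)%R by rewrite lt0r_neq0 // pi_gt0.
  by move: (pi : R) pi0 (sin t) (lt0r_neq0 st) => P P0 S S0; field; rewrite P0 S0.
- have sub (t : R) : t \in `[eps n, (pi - eps n)%R] -> (0 <= t <= pi)%R.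
    by move=> /(@in0pi n)/andP[/ltW -> /ltW ->].
  by move=> x y /sub xI /sub yI xy; rewrite /F ltr_pM2l // cos_lt.
- by apply: (cvgP (derive1 F (eps n) : R)); apply: cvg_at_right_filter; have := cF' (eps n).
- by apply: (cvgP (derive1 F (pi - eps n)%R : R)); apply: cvg_at_left_filter; have := cF' (pi - eps n)%R.
- split.
  + by move=> t _; exact: ex_derive.
  + by apply: cvg_at_right_filter; exact: continuous_2cos.
  + by apply: cvg_at_left_filter; exact: continuous_2cos.
- apply: continuous_in_subspaceT => x; rewrite inE => xI.
  by apply: continuous_arcsine_density => //; exact: (@segm_sub n).
Qed.

(** Monotone convergence along the truncated intervals, applied on both sides; this is why [f] is
    nonnegative here. *)
Let ge0_arcsine_law f : continuous f -> (forall x, (0 <= f x)%R) ->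
  \int[mu]_(x in `[(-2)%R, 2%R]) (f x * arcsine_density x)%:E = (arcsine_mean f)%:E.
Proof.
move=> cf f0.
have mf1 : measurable_fun (`](-2)%R, 2%R[%classic : set R)
    (fun x => f x * arcsine_density x : R)%R.
  apply: open_continuous_measurable_fun; first exact: interval_open.
  by move=> x; rewrite inE /= in_itv /= => xI; exact: continuous_arcsine_density.
have cf2 : continuous (fun t : R => pi^-1 * f (2 * cos t))%R.
  by move=> t; apply: cvgM; [exact: cvg_cst|exact: continuous_comp_2cos].
have mf2 (D : set R) : measurable D ->
    measurable_fun D (fun t => pi^-1 * f (2 * cos t) : R)%R.
  by move=> mD; apply: measurable_funTS; exact: continuous_measurable_fun.
transitivity (\int[mu]_(t in `[0%R, pi]) (pi^-1 * f (2 * cos t))%:E); last first.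
  under eq_integral do rewrite EFinM.
  rewrite integralZl //; last exact: integrable_comp_2cos.
  rewrite /arcsine_mean /Rintegral EFinM fineK //.
  by apply: integrable_fin_num => //; exact: integrable_comp_2cos.
rewrite integral_itv_bndoo; last exact/measurable_EFinP.
rewrite [RHS]integral_itv_bndoo; last by apply/measurable_EFinP; apply: mf2; exact: measurable_itv.
rewrite -bigcup_segm -bigcup_angle.
have c1 : \int[mu]_(x in segm n) (f x * arcsine_density x)%:E @[n --> \oo] -->
    \int[mu]_(x in \bigcup_n segm n) (f x * arcsine_density x)%:E.
  apply: ge0_nondecreasing_set_cvg_integral => //.
  - by move=> n; exact: measurable_itv.
  - move=> n; apply/measurable_EFinP; apply: measurable_funS mf1 => //.
    by rewrite -bigcup_segm; exact: bigcup_sup.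
  - by move=> n x _; rewrite lee_fin mulr_ge0 ?arcsine_density_ge0.
have c2 : \int[mu]_(t in angle n) (pi^-1 * f (2 * cos t))%:E @[n --> \oo] -->
    \int[mu]_(t in \bigcup_n angle n) (pi^-1 * f (2 * cos t))%:E.
  apply: ge0_nondecreasing_set_cvg_integral => //.
  - by move=> n; exact: measurable_itv.
  - by move=> n; apply/measurable_EFinP; apply: mf2; exact: measurable_itv.
  - by move=> n x _; rewrite lee_fin mulr_ge0 // invr_ge0 pi_ge0.
apply: cvg_unique c2 => //.
by move: c1; under eq_fun do rewrite (substitution _ cf).
Qed.

(** Adding the bound [M] to [f] reduces to nonnegative functions. *)
Lemma arcsine_law f : bounded_continuous f ->
  \int[mu]_(x in `[(-2)%R, 2%R]) (f x / (pi * Num.sqrt (4 - x ^+ 2)))%:E = (arcsine_mean f)%:E.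
Proof.
case=> cf [M HM].
have M0 : (0 <= M)%R by apply: le_trans (HM 0%R).
have cM : continuous (fun _ : R => M) by move=> x; exact: cvg_cst.
pose g := (f \+ (fun=> M))%R.
have cg : continuous g by move=> x; apply: cvgD; [exact: cf|exact: cM].
have g0 x : (0 <= g x)%R by rewrite /g /=; have := HM x; rewrite ler_norml => /andP[? ?]; lra.
have integ (h : R -> R) : continuous h -> (forall x, (0 <= h x)%R) ->
    mu.-integrable `[(-2)%R, 2%R] (EFin \o (fun x => h x * arcsine_density x)%R).
  move=> ch h0; apply/integrableP; split.
    apply/emeasurable_fun_itv_obnd_cbndP/emeasurable_fun_itv_bndo_bndcP.
    apply/measurable_EFinP; apply: open_continuous_measurable_fun; first exact: interval_open.
    by move=> x; rewrite inE /= in_itv /= => xI; exact: continuous_arcsine_density.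
  rewrite [ltLHS](_ : _ = (arcsine_mean h)%:E) ?ltry // -ge0_arcsine_law //.
  by apply: eq_integral => x _; rewrite /= ger0_norm // mulr_ge0 // arcsine_density_ge0.
transitivity (\int[mu]_(x in `[(-2)%R, 2%R])
    ((g x * arcsine_density x)%:E - (M * arcsine_density x)%:E)).
  by apply: eq_integral => x _; rewrite -EFinB /g /arcsine_density /=; congr (_%:E); ring.
rewrite integralB_EFin //; [|exact: integ|exact: (integ (fun=> M))].
rewrite !ge0_arcsine_law // /g arcsine_meanD // -EFinB.
by rewrite addrK.
Qed.

(** The witness is the law of 2 cos t for t uniform on [0, pi]. *)
Lemma arcsine_probability : exists nu : probability R R, forall f,
  bounded_continuous f -> \int[nu]_x (f x)%:E = (arcsine_mean f)%:E.
Proof.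
pose X : measurableTypeR R -> R := (fun t : R => 2 * cos t)%R.
have mX : measurable_fun [set: measurableTypeR R] X.
  by apply: continuous_measurable_fun; exact: continuous_2cos.
pose XM := @isMeasurableFun.Build _ _ (measurableTypeR R) R X mX.
pose X' : {mfun (measurableTypeR R) >-> R} := HB.pack X XM.
pose U : probability (measurableTypeR R) R := uniform_prob (pi_gt0 R).
exists (distribution U X') => f [cf [M HM]].
have M0 : (0 <= M)%R by apply: le_trans (HM 0%R).
have cM : continuous (fun _ : R => M) by move=> x; exact: cvg_cst.
pose g := (f \+ (fun=> M))%R.
have cg : continuous g by move=> x; apply: cvgD; [exact: cf|exact: cM].
have g0 x : (0 <= g x)%R by rewrite /g /=; have := HM x; rewrite ler_norml => /andP[? ?]; lra.
have ge0 (h : R -> R) : continuous h -> (forall x, (0 <= h x)%R) ->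
    \int[distribution U X']_x (h x)%:E = (arcsine_mean h)%:E.
  move=> ch h0; rewrite ge0_integral_distribution //; last first.
    by apply/measurable_EFinP; exact: continuous_measurable_fun.
  rewrite integral_uniform //; last first.
  - by move=> x; rewrite lee_fin.
  - by apply/measurable_EFinP; apply: continuous_measurable_fun; exact: continuous_comp_2cos.
  rewrite /arcsine_mean /Rintegral EFinM subr0 fineK //.
  by apply: integrable_fin_num => //; exact: integrable_comp_2cos.
have integ (h : R -> R) : continuous h -> (forall x, (0 <= h x)%R) ->
    (distribution U X').-integrable setT (EFin \o h).
  move=> ch h0; apply/integrableP; split.
    by apply/measurable_EFinP; exact: continuous_measurable_fun.
  rewrite [ltLHS](_ : _ = (arcsine_mean h)%:E) ?ltry // -ge0 //.
  by apply: eq_integral => x _; rewrite /= ger0_norm.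
transitivity (\int[distribution U X']_x ((g x)%:E - M%:E)).
  by apply: eq_integral => x _; rewrite -EFinB /g /= addrK.
rewrite integralB_EFin //; [|exact: integ|exact: (integ (fun=> M))].
rewrite !ge0 // /g arcsine_meanD // -EFinB.
by rewrite addrK.
Qed.

End ArcsineLaw.

(** * Spectral measures of graphs that are mostly lines *)

Section AdjacencyMatrix.
Variables (R : realType) (V : finType) (m : V -> V -> nat) (N : nat) (e : 'I_N -> V).

(** The size [N] is kept apart from [#|V|], so that it can be generalized to a successor when
    polynomials of the matrix are formed. *)
Definition adj_mx : 'M[R]_N := \matrix_(i, j) (symm m (e i) (e j))%:R.

Lemma symm_sym x y : symm m x y = symm m y x.
Proof. by rewrite /symm eq_sym; case: eqVneq => [->|_] //; rewrite addnC. Qed.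

Lemma adj_mx_sym : adj_mx^T = adj_mx.
Proof. by apply/matrixP => i j; rewrite !mxE symm_sym. Qed.

End AdjacencyMatrix.

Section Spectrum.
Variables (R : realType) (V : finType) (m : V -> V -> nat) (N : nat) (e : 'I_N.+1 -> V).
Variable (D : nat).
Hypotheses (e_bij : bijective e) (deg : forall x, (\sum_y symm m x y <= D)%N).
Notation A := (adj_mx R m e).

Lemma adj_mx_row_sum i : \sum_j A i j <= D%:R.
Proof.
under eq_bigr do rewrite mxE.
rewrite -natr_sum ler_nat; apply: leq_trans (deg (e i)).
by rewrite (reindex e) //; exact: onW_bij.
Qed.

Lemma adj_mx_ge0 i j : 0 <= A i j.
Proof. by rewrite mxE. Qed.

Lemma adj_mx_pow_row_sum k i : \sum_j `|(A ^+ k) i j| <= D%:R ^+ k.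
Proof.
elim: k i => [|k IH] i.
  rewrite expr0 (bigD1 i) //= mxE eqxx normr1 big1 ?addr0 // => j ji.
  by rewrite mxE eq_sym (negPf ji) normr0.
rewrite exprS; apply: (@le_trans _ _ (\sum_j \sum_l A i l * `|(A ^+ k) l j|)).
  apply: ler_sum => j _; rewrite mxE; apply: le_trans (ler_norm_sum _ _ _) _.
  by apply: ler_sum => l _; rewrite normrM (ger0_norm (adj_mx_ge0 _ _)).
rewrite exchange_big /= exprS; apply: (@le_trans _ _ (\sum_l A i l * D%:R ^+ k)).
  by apply: ler_sum => l _; rewrite -mulr_sumr ler_wpM2l // adj_mx_ge0.
by rewrite -mulr_suml ler_wpM2r ?exprn_ge0 // adj_mx_row_sum.
Qed.

Lemma adj_mx_pow_diag k i : `|(A ^+ k) i i| <= D%:R ^+ k.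
Proof.
apply: le_trans (adj_mx_pow_row_sum k i).
by rewrite (bigD1 i) //= lerDl sumr_ge0.
Qed.

(** Compare both sides of the eigenvector equation at a coordinate of largest modulus. All spectra
    thus lie in one compact interval, on which test functions can be replaced by polynomials. *)
Lemma adj_mx_eigenvalue (a : R) : root (char_poly A) a -> `|a| <= D%:R.
Proof.
rewrite -eigenvalue_root_char => /eigenvalueP[u uA u0].
have [i _ imax] := @arg_maxP _ _ _ (ord0 : 'I_N.+1) predT (fun i => `|u 0 i|) isT.
have ui : 0 < `|u 0 i|.
  rewrite lt_def normr_ge0 andbT; apply: contraNneq u0 => u0.
  apply/eqP/matrixP => k j; rewrite ord1 mxE; apply/eqP.
  rewrite -normr_le0 -u0; exact: imax.
have : `|a| * `|u 0 i| <= D%:R * `|u 0 i|.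
  rewrite -normrM; have -> : a * u 0 i = \sum_j u 0 j * A j i.
    by have /matrixP/(_ 0 i) := uA; rewrite !mxE => <-.
  apply: le_trans (ler_norm_sum _ _ _) _.
  apply: (@le_trans _ _ (\sum_j `|u 0 i| * A i j)).
    apply: ler_sum => j _; rewrite normrM (ger0_norm (adj_mx_ge0 _ _)).
    have -> : A j i = A i j by rewrite !mxE symm_sym.
    by rewrite ler_wpM2r ?adj_mx_ge0 //; exact: imax.
  by rewrite -mulr_sumr mulrC ler_wpM2r ?adj_mx_row_sum.
by rewrite ler_pM2r.
Qed.

(** The bound depends only on [q] and [D], so each exceptional vertex contributes a bounded error
    whatever the graph. *)
Lemma horner_adj_diag_bound (q : {poly R}) i :
  `|(horner_mx A q) i i| <= \sum_(k < size q) `|q`_k| * D%:R ^+ k.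
Proof.
have -> : horner_mx A q = \sum_(k < size q) q`_k *: A ^+ k.
  rewrite -[in LHS](coefK q) poly_def rmorph_sum; apply: eq_bigr => k _.
  by rewrite /= horner_mxZ rmorphXn /= horner_mx_X.
rewrite summxE; apply: le_trans (ler_norm_sum _ _ _) _.
apply: ler_sum => k _; rewrite mxE normrM ler_wpM2l //; exact: adj_mx_pow_diag.
Qed.

(* On a line the j-th Chebyshev polynomial of the adjacency operator S + S^-1 is S^j + S^-j. *)
Lemma horner_chebyshev_diag r v j : line_nbhd m r (e v) -> (j <= r)%N ->
  (horner_mx A (chebyshev R j)) v v = (j == 0)%:R * 2.
Proof.
case=> x [xv xI xm x0] jr; have [g eK gK] := e_bij.
pose c i : 'cV[R]_N.+1 := delta_mx (g (x i)) 0.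
have cE i k : c i k 0 = (e k == x i)%:R.
  by rewrite mxE eqxx andbT; congr (nat_of_bool _)%:R; rewrite -(inj_eq (can_inj eK)) gK.
have Ac i : (i.+1 < r.*2)%N -> A *m c i.+1 = c i + c i.+2.
  move=> ir; apply/matrixP => k l; rewrite ord1 [in RHS]mxE !cE mxE (bigD1 (g (x i.+1))) //=.
  rewrite big1 ?addr0 => [|k' /negPf k'x]; last by rewrite [c _ _ _]mxE k'x mulr0.
  rewrite [c _ _ _]mxE !eqxx mulr1 mxE gK -natrD; congr _%:R; rewrite /symm.
  have [h1 h2] := xm _ ir (e k); have [h3 h4] := xm _ (ltnW ir) (e k).
  case: eqVneq => [E|_]; last by rewrite h1 h4.
  rewrite E (line_arcs xI xm x0) ?(ltnW ir) //.
  have xeq a b : (a <= r.*2)%N -> (b <= r.*2)%N -> (x a == x b) = (a == b).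
    by move=> ? ?; rewrite (inj_in_eq xI).
  by rewrite !xeq; lia.
(* Two consecutive indices match the two-step recursion; [k.+1 <= r] keeps subtractions exact and
   vertices on the path. *)
have H k : (k.+1 <= r)%N -> horner_mx A (chebyshev R k) *m c r = c (r + k)%N + c (r - k)%N /\
    horner_mx A (chebyshev R k.+1) *m c r = c (r + k.+1)%N + c (r - k.+1)%N.
  elim: k => [|k IH] kr.
    split; first by rewrite /= horner_mx_C mul_scalar_mx addn0 subn0 scaler_nat mulr2n.
    rewrite /= horner_mx_X; have := @Ac r.-1; rewrite prednK //.
    by rewrite addn1 subn1 addrC => -> //; lia.
  have [IH1 IH2] := IH (ltnW kr); split=> //.
  rewrite chebyshevSS rmorphB rmorphM /= horner_mx_X mulmxBl -mulmxA IH1 IH2 mulmxDr.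
  have := @Ac (r + k)%N; rewrite addnS => -> //; last by lia.
  have := @Ac (r - k.+2)%N.
  have -> : (r - k.+2).+2 = (r - k)%N by lia.
  have -> : (r - k.+2).+1 = (r - k.+1)%N by lia.
  move=> -> //; last by lia.
  by rewrite !addnS; apply/matrixP => a b; rewrite !mxE; ring.
have vE : v = g (x r) by rewrite xv eK.
have diag (M : 'M[R]_N.+1) : M v v = (M *m c r) v 0.
  rewrite mxE (bigD1 v) //= big1 ?addr0 => [|k kv]; rewrite cE xv.
    by rewrite eqxx mulr1.
  by rewrite (inj_eq (can_inj eK)) (negPf kv) mulr0.
have neq i : (i <= r.*2)%N -> i != r -> c i v 0 = 0.
  by move=> ir ii; rewrite cE -xv (inj_in_eq xI) ?inE ?ir //; [rewrite eq_sym (negPf ii)|lia].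
rewrite diag; case: j jr => [|j] jr.
  by rewrite /= horner_mx_C mul_scalar_mx mxE cE xv eqxx mulr1 mul1r.
have [_ ->] := H _ jr; rewrite mxE !neq ?mul0r ?addr0 //; lia.
Qed.

End Spectrum.

(** * From Chebyshev polynomials to all test functions *)

Section Moments.
Variable R : realType.
Implicit Types p q : {poly R}.

(** The radius [r0] depends on [q] alone, uniformly over graphs, so the property is stable under
    linear combinations. *)
Definition line_moment q := exists r0, forall r (V : finType) (m : V -> V -> nat)
  (N : nat) (e : 'I_N.+1 -> V) v, (r0 <= r)%N -> bijective e -> line_nbhd m r (e v) ->
  (horner_mx (adj_mx R m e) q) v v = arcsine_mean (horner q).

Lemma line_momentD p q : line_moment p -> line_moment q -> line_moment (p + q).
Proof.
case=> [r1 H1] [r2 H2]; exists (maxn r1 r2) => r V m N e v.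
rewrite geq_max => /andP[l1 l2] eb lv.
rewrite rmorphD /= mxE (H1 r) // (H2 r) // -arcsine_meanD; try exact: continuous_horner.
by congr arcsine_mean; apply/funext => x; rewrite /= hornerD.
Qed.

Lemma line_momentZ (a : R) q : line_moment q -> line_moment (a *: q).
Proof.
case=> [r1 H1]; exists r1 => r V m N e v l1 eb lv.
rewrite horner_mxZ mxE (H1 r) // -arcsine_meanZ; last exact: continuous_horner.
by congr arcsine_mean; apply/funext => x; rewrite /= hornerZ.
Qed.

Lemma line_moment_chebyshev j : line_moment (chebyshev R j).
Proof.
exists j => r V m N e v l1 eb lv; rewrite (horner_chebyshev_diag R eb lv l1).
case: j {l1} => [|j]; last by rewrite arcsine_mean_chebyshev // mul0r.
rewrite mul1r -[LHS](arcsine_mean_cst (2 : R)).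
by congr arcsine_mean; apply/funext => x; rewrite /= hornerC.
Qed.

(** Multiplication by X sends C_j to C_(j+1) + C_(j-1), and C_0 to 2 C_1, so the power of X is
    lowered at the cost of changing [j]. *)
Lemma line_moment_Xn_chebyshev n j : line_moment ('X^n * chebyshev R j).
Proof.
elim: n j => [|n IH] j; first by rewrite expr0 mul1r; exact: line_moment_chebyshev.
case: j => [|j].
  have -> : 'X^(n.+1) * chebyshev R 0 = 2 *: ('X^n * chebyshev R 1).
    by rewrite exprSr /= -mul_polyC; ring.
  exact: line_momentZ.
have -> : 'X^(n.+1) * chebyshev R j.+1 = 'X^n * chebyshev R j.+2 + 'X^n * chebyshev R j.
  by rewrite chebyshevSS exprSr; ring.
exact: line_momentD.
Qed.

Lemma line_moment_all q : line_moment q.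
Proof.
rewrite -(coefK q) poly_def; elim/big_ind: _ => [||i _].
- have -> : (0 : {poly R}) = 0 *: chebyshev R 0 by rewrite scale0r.
  exact/line_momentZ/line_moment_chebyshev.
- exact: line_momentD.
(* Monomials are reached because C_0 is the constant 2. *)
- have -> : q`_i *: 'X^i = (q`_i / 2) *: ('X^i * chebyshev R 0).
    by rewrite /= -!mul_polyC [RHS]mulrCA -polyCM divfK ?pnatr_eq0 // mulrC.
  exact/line_momentZ/line_moment_Xn_chebyshev.
Qed.

(** The sum is a trace, and diagonal entries at line vertices equal the mean exactly; only the other
    vertices contribute to the error. *)
Lemma poly_spectral_sum q D (eps : R) : 0 < eps -> exists r, exists2 d : R, 0 < d &
  forall (V : finType) (m : V -> V -> nat) (N : nat) (e : 'I_N.+1 -> V) (s : seq R),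
  bijective e -> (forall x, (\sum_y symm m x y <= D)%N) ->
  #|[pred x | ~~ `[< line_nbhd m r x >]]|%:R <= d * N.+1%:R ->
  (forall p, \tr (horner_mx (adj_mx R m e) p) = \sum_(x <- s) p.[x]) ->
  `|\sum_(x <- s) q.[x] - arcsine_mean (horner q) * N.+1%:R| <= eps * N.+1%:R.
Proof.
move=> eps0; have [r Hr] := line_moment_all q.
pose I := arcsine_mean (horner q).
pose B := \sum_(k < size q) `|q`_k| * D%:R ^+ k + `|I|.
have B0 : 0 <= B by rewrite addr_ge0 // sumr_ge0 // => k _; rewrite mulr_ge0 // exprn_ge0.
(* [B] bounds the error of one exceptional vertex; adding 1 keeps the denominator positive. *)
exists r; exists (eps / (B + 1)); first by rewrite divr_gt0 //; lra.
move=> V m N e s eb deg bad tr; rewrite -tr.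
have -> : I * N.+1%:R = \sum_(i < N.+1) I by rewrite sumr_const card_ord mulr_natr.
rewrite -sumrB; apply: le_trans (ler_norm_sum _ _ _) _.
pose P := [pred x | ~~ `[< line_nbhd m r x >]].
apply: (@le_trans _ _ (\sum_i B * (P (e i))%:R)).
  apply: ler_sum => i _; rewrite /P /=; case: asboolP => [lv|_].
    by rewrite (Hr r) // subrr normr0 mulr0.
  rewrite mulr1; apply: le_trans (ler_normB _ _) _; rewrite lerD2r.
  exact: horner_adj_diag_bound.
rewrite -mulr_sumr -natr_sum.
have -> : (\sum_i P (e i) = #|P|)%N.
  rewrite -sum1_card [RHS]big_mkcond (reindex e) /=; last exact: onW_bij.
  by apply: eq_bigr => i _; rewrite unfold_in /=; case: (~~ _).
apply: le_trans (ler_wpM2l B0 bad) _.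
rewrite mulrA ler_wpM2r // mulrA ler_pdivrMr; last by lra.
by rewrite mulrC; nra.
Qed.

(** Three errors of eps / 3: [f] against [q] on the spectrum, the spectral mean of [q], and [q]
    against [f] in the arcsine mean. The segment [-D, D] contains the spectrum and, as D >= 2, the
    support of the arcsine law. *)
Lemma spectral_integral_approx f D (eps : R) : bounded_continuous f -> (1 < D)%N -> 0 < eps ->
  exists r, exists2 d : R, 0 < d &
  forall (V : finType) (m : V -> V -> nat) (N : nat) (e : 'I_N -> V), (0 < N)%N ->
  bijective e -> (forall x, (\sum_y symm m x y <= D)%N) ->
  #|[pred x | ~~ `[< line_nbhd m r x >]]|%:R <= d * N%:R ->
  `|spectral_integral (adj_mx R m e) f - arcsine_mean f| <= eps.
Proof.
move=> bf D1 eps0; have e30 : 0 < eps / 3 by rewrite divr_gt0.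
have D0 : (0 : R) < D%:R by rewrite ltr0n ltnW.
have [q Hq] := weierstrass bf D0 e30.
have [r [d d0 H]] := poly_spectral_sum q D e30.
exists r; exists d => // V m [//|N] e _ eb deg bad.
have [s [sz cp tr]] := real_spectrum (adj_mx_sym R m e).
rewrite (spectral_integral_sum _ cp).
have := H V m N e s eb deg bad tr.
have sD x : x \in s -> `|f x - q.[x]| <= eps / 3.
  move=> xs; apply: Hq; rewrite -ler_norml; apply: (adj_mx_eigenvalue (m := m) (e := e)) => //.
  by rewrite cp root_prod_XsubC.
have h1 : `|\sum_(x <- s) f x - \sum_(x <- s) q.[x]| <= eps / 3 * N.+1%:R.
  rewrite -sumrB; apply: le_trans (ler_norm_sum _ _ _) _.
  rewrite -sz -sum1_size natr_sum mulr_sumr big_seq [leRHS]big_seq.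
  by apply: ler_sum => x xs; rewrite mulr1 sD.
have h2 : `|arcsine_mean f - arcsine_mean (horner q)| <= eps / 3.
  apply: arcsine_mean_dist; [exact: bf.1|exact: continuous_horner|] => x /andP[x1 x2].
  apply: Hq; have : (2 : R) <= D%:R by rewrite ler_nat.
  by move=> ?; apply/andP; split; lra.
have N0 : 0 < N.+1%:R :> R by rewrite ltr0n.
move=> h3; set S := \sum_(x <- s) f x in h1 *; set Q := \sum_(x <- s) q.[x] in h1 h3.
have -> : N.+1%:R^-1 * S - arcsine_mean f = N.+1%:R^-1 * (S - arcsine_mean f * N.+1%:R).
  by field; rewrite lt0r_neq0.
rewrite normrM gtr0_norm ?invr_gt0 // mulrC ler_pdivrMr //.
have -> : S - arcsine_mean f * N.+1%:R = (S - Q) + (Q - arcsine_mean (horner q) * N.+1%:R) -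
   (arcsine_mean f - arcsine_mean (horner q)) * N.+1%:R by ring.
apply: le_trans (ler_normB _ _) _; apply: le_trans (lerD (ler_normD _ _) (lexx _)) _.
rewrite normrM (gtr0_norm N0); have := ler_wpM2r (ltW N0) h2.
lra.
Qed.

End Moments.

(** * Spectral limits of Rauzy graphs *)

Section SpectralLimits.
Variables (R : realType) (A : finType) (L : pred (seq A)).
Hypotheses (HA : (1 < #|A|)%N) (Hfact : factorial_lang L)
  (Hprol : almost_prolongable L R) (Hunb : unbounded_complexity L).

Notation p := (complexity L).
Notation W := (Lw L).
Notation integral_of f n := (spectral_integral (rauzy_adj L R n) f).

Let p0 n : (0 : R) < (p n)%:R.
Proof. by rewrite ltr0n; exact: complexity_gt0. Qed.

Lemma rauzy_adjE n : rauzy_adj L R n = adj_mx R (@rauzy_arcs A L n) (@enum_val (W n) (W n)).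
Proof. by []. Qed.

Lemma spectral_near (f : R -> R) (e : R) : bounded_continuous f -> 0 < e ->
  exists2 d : R, 0 < d & \forall n \near \oo, (p n.+1)%:R <= (1 + d) * (p n)%:R ->
    `|integral_of f n - arcsine_mean f| <= e.
Proof.
move=> bf e0; have D1 : (1 < #|A|.*2)%N by lia.
have [r [d' d'0 H]] := spectral_integral_approx bf D1 e0.
have [d d0 Hd] := not_line_small HA Hfact Hprol Hunb r d'0.
exists d => //; apply: filterS Hd => n Hd /Hd bad; rewrite rauzy_adjE.
apply: H => //; first exact: complexity_gt0.
by move=> x; exact: (edges_le HA Hfact x).
Qed.

Lemma ratio_spectral_cvg (f : R -> R) : bounded_continuous f ->
  ((fun n => (p n.+1)%:R / (p n)%:R : R) @ \oo --> (1 : R)) ->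
  (fun n => (integral_of f n)%:E) @ \oo --> (arcsine_mean f)%:E.
Proof.
move=> bf ratio; apply: cvg_EFin; first exact: nearW.
apply/cvgrPdist_le => e e0; have [d d0 H] := spectral_near bf e0.
apply: filterS2 H (ratio_le_near HA Hfact Hunb ratio d0) => n H /H.
by rewrite distrC.
Qed.

Lemma Z_spectral : BS_conv_to_Z R (@rauzy_edges A L) ->
  subexponential L R /\ exists nu : probability R R, spectral_weak_cvg (@rauzy_adj A L R) nu.
Proof.
move=> /(Z_ratio HA Hfact Hprol Hunb) ratio; split; first exact: ratio_subexponential.
have [nu Hnu] := arcsine_probability R; exists nu => f bf.
by rewrite Hnu //; exact: ratio_spectral_cvg.
Qed.

Lemma probability_integral_fin_num (nu : probability R R) (f : R -> R) :
  bounded_continuous f -> (\int[nu]_x (f x)%:E)%E \is a fin_num.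
Proof.
case=> cf [M HM]; apply: integrable_fin_num => //.
apply: measurable_bounded_integrable => //.
- by rewrite (@le_lt_trans _ _ 1%E) ?ltry //; exact: probability_le1.
- exact: continuous_measurable_fun.
- exists M; split; first exact: num_real.
  by move=> y My x _; exact: le_trans (HM x) (ltW My).
Qed.

Lemma spectral_arcsine : subexponential L R ->
  (exists nu : probability R R, spectral_weak_cvg (@rauzy_adj A L R) nu) ->
  spectral_cvg_arcsine (@rauzy_adj A L R).
Proof.
move=> sub [nu Hnu] f bf; rewrite arcsine_law //.
have Hf := Hnu f bf.
have fn := probability_integral_fin_num nu bf.
suff <- : (\int[nu]_x (f x)%:E = (arcsine_mean f)%:E)%E by [].
rewrite -(fineK fn) in Hf *; congr (_%:E).
have Hf' := fine_cvg Hf.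
apply: (cvg_frequently (Hf' _)) => e N e0 /=.
have [d d0 [M _ HM]] := spectral_near bf e0.
have [n nNM hn] := subexponential_ratio HA Hfact Hunb sub (maxn N M) d0.
by move: nNM; rewrite geq_max => /andP[Nn Mn]; exists n => //; exact: HM.
Qed.

(** The sum of squared eigenvalues is the trace of the squared matrix, the sum of squared entries;
    entries are natural numbers, hence at most their squares. *)
Lemma rauzy_spectrum n : (0 < p n)%N -> exists2 s : seq R,
  size s = p n & char_poly (rauzy_adj L R n) = \prod_(x <- s) ('X - x%:P) /\
  [/\ forall x, x \in s -> `|x| <= #|A|.*2%:R &
   (\sum_(x : W n) \sum_y rauzy_edges x y)%:R <= \sum_(x <- s) x ^+ 2].
Proof.
rewrite rauzy_adjE; set e := enum_val; have eb : bijective e by exact: enum_val_bij.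
move: e eb; rewrite /complexity; move: #|{: W n}| => [//|N] e eb _.
have [s [sz cp tr]] := real_spectrum (adj_mx_sym R (@rauzy_arcs A L n) e).
exists s => //; split=> //; split.
  move=> x xs; apply: (adj_mx_eigenvalue (m := @rauzy_arcs A L n) (e := e)) => //.
    by move=> y; exact: (edges_le HA Hfact y).
  by rewrite cp root_prod_XsubC.
have := tr 'X^2; under [RHS]eq_bigr do rewrite hornerXn.
move=> <-; rewrite rmorphXn /= horner_mx_X expr2 /mxtrace natr_sum.
rewrite (reindex e) /=; last exact: onW_bij.
apply: ler_sum => i _; rewrite mxE natr_sum (reindex e) /=; last exact: onW_bij.
apply: ler_sum => j _; rewrite !mxE (symm_sym _ (e j)) -natrM ler_nat -/(rauzy_edges _ _).
by rewrite -[symm _ _ _]/(rauzy_edges (e i) (e j)); case: (rauzy_edges _ _) => // k; nia.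
Qed.

Lemma arcsine_second_moment : arcsine_mean (horner ('X^2 : {poly R})) = 2.
Proof.
have -> : horner ('X^2 : {poly R}) = horner (chebyshev R 2) \+ (fun=> 2).
  by apply/funext => x; rewrite /= hornerXn hornerD hornerN hornerM hornerX hornerC; ring.
rewrite arcsine_meanD; [|exact: continuous_horner|by move=> x; exact: cvg_cst].
by rewrite arcsine_mean_chebyshev // arcsine_mean_cst add0r.
Qed.

Lemma arcsine_ratio : spectral_cvg_arcsine (@rauzy_adj A L R) ->
  ((fun n => (p n.+1)%:R / (p n)%:R : R) @ \oo --> (1 : R)).
Proof.
move=> H; apply: ratio_cvg1 => // d d0.
pose D : R := #|A|.*2%:R.
have D2 : 2 <= D by rewrite ler_nat; lia.
(* Truncated square: it agrees with x^2 on the spectra and on the support of the limit. *)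
pose f (x : R) := Num.min (x ^+ 2) (D ^+ 2).
have fE x : `|x| <= D -> f x = x ^+ 2.
  move=> xD; apply/min_idPl; rewrite -[x ^+ 2]real_normK ?num_real //.
  by rewrite ler_sqr ?nnegrE ?normr_ge0 //; lra.
have bf : bounded_continuous f.
  split; last first.
    exists (D ^+ 2) => x; rewrite ger0_norm ?ge_min ?lexx ?orbT //.
    by rewrite le_min !sqr_ge0.
  move=> x; apply: (@continuous_min _ _ (fun x : R => x ^+ 2) (fun=> D ^+ 2)).
    exact: exprn_continuous.
  exact: cvg_cst.
have f2 : arcsine_mean f = 2.
  rewrite -arcsine_second_moment; apply/eqP; rewrite -subr_eq0 -normr_le0.
  apply: arcsine_mean_dist; [exact: bf.1|exact: continuous_horner|].
  move=> x /andP[x1 x2]; rewrite hornerXn fE ?subrr ?normr0 //.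
  by rewrite ler_norml; apply/andP; split; lra.
have := H f bf; rewrite arcsine_law // f2 => /fine_cvg /=.
move/cvgrPdist_le/(_ _ d0).
pose a : R := #|A|%:R.
have [K HK] : exists K : nat, a / d <= K%:R.
  by exists (Num.truncn (a / d)).+1; apply: ltW; rewrite truncnS_gt.
apply: filterS3 (complexity_near HA Hfact Hprol Hunb K) (nbhs_infty_gt 0) => n pK n0.
have [s sz [cp [sD sE]]] := rauzy_spectrum (complexity_gt0 HA Hfact Hunb n).
rewrite /comp /= (spectral_integral_sum _ cp) ler_norml => /andP[h _].
have E : \sum_(x <- s) f x = \sum_(x <- s) x ^+ 2.
  by apply: eq_big_seq => x xs; rewrite fE // sD.
rewrite E in h.
have := sum_edges HA Hfact n0; rewrite -(ler_nat R) natrD -!muln2 natrM -/a => h1.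
have h2 : \sum_(x <- s) x ^+ 2 <= (2 + d) * (p n)%:R.
  rewrite -ler_pdivrMr // mulrC.
  by move: h; rewrite -/(p n); lra.
have h3 : a <= d * (p n)%:R.
  rewrite mulrC -ler_pdivrMr //; apply: le_trans HK _; by rewrite ler_nat ltnW.
lra.
Qed.

Lemma ratio_dZ : ((fun n => (p n.+1)%:R / (p n)%:R : R) @ \oo --> (1 : R)) ->
  BS_conv_to_dZ R (@rauzy_arcs A L).
Proof.
move=> ratio r; apply: ball_freq_cvg1 => e e0.
have [d d0 H] := dZ_freq HA Hfact Hprol Hunb r e0.
by apply: filterS2 H (ratio_le_near HA Hfact Hunb ratio d0) => n H /H.
Qed.

End SpectralLimits.

Theorem theorem1p1 (R : realType) (A : finType) (L : pred (seq A))
  (HA : (1 < #|A|)%N)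
  (Hfact : factorial_lang L)
  (Hprol : almost_prolongable L R)
  (Hunb : unbounded_complexity L) :
  [<-> (* (1) *) subexponential L R /\ BS_limit_exists R (@rauzy_edges A L);
       (* (2) *) BS_conv_to_Z R (@rauzy_edges A L);
       (* (3) *) subexponential L R /\
                 exists nu : probability R R, spectral_weak_cvg (@rauzy_adj A L R) nu;
       (* (4) *) spectral_cvg_arcsine (@rauzy_adj A L R);
       (* (5) *) (fun n => (complexity L n.+1)%:R / (complexity L n)%:R : R) @ \oo --> (1 : R);
       (* (6) *) subexponential L R /\ BS_limit_exists R (@rauzy_arcs A L);
       (* (7) *) BS_conv_to_dZ R (@rauzy_arcs A L)].
Proof.
have V0 n : (0 < #|Lw L n|)%N by exact: complexity_gt0.
tfae.
- by case=> sub BS; exact: subexp_BS_Z.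
- exact: Z_spectral.
- by case=> sub nu; exact: spectral_arcsine.
- exact: arcsine_ratio.
- move=> ratio; split; first exact: ratio_subexponential.
  by apply: (BS_limit_of_rooted V0); exact: ratio_dZ.
- by case=> sub BS; exact: subexp_BS_dZ.
(* The cycle closes through the undirected line, which yields both the growth rate and the limit of
   the undirected graphs. *)
- move=> /(dZ_Z HA Hfact Hunb) Z; split.
    exact: ratio_subexponential (Z_ratio HA Hfact Hprol Hunb Z).
  exact: BS_limit_of_rooted Z.
Qed.
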